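(* Let $n\geq1$, $m\geq1$, let $\mathcal{X}^1,\dots,\mathcal{X}^n,\mathcal{Y}^1,\dots,\mathcal{Y}^m$ be $\mathcal{C}^\infty$-smooth functions of $(x^1,\dots,x^n,y^1,\dots,y^m)\in\mathbb{K}^{n+m}$, and let $\mathbf{Y}_{i_1,\dots,i_\kappa}^j$ be the coefficients of the prolongations of the vector field $\sum_{i=1}^n\mathcal{X}^i\frac{\partial}{\partial x^i}+\sum_{j=1}^m\mathcal{Y}^j\frac{\partial}{\partial y^j}$, as defined in the context. For every $j\in\{1,\dots,m\}$, every $\kappa\geq1$ and every choice of indices $i_1,\dots,i_\kappa\in\{1,\dots,n\}$, $$ \begin{aligned} \mathbf{Y}_{i_1,\dots,i_\kappa}^j &=\frac{\partial^\kappa\mathcal{Y}^j}{\partial x^{i_1}\cdots\partial x^{i_\kappa}} +\sum_{d=1}^{\kappa+1}\ \sum_{1\leq\lambda_1<\cdots<\lambda_d\leq\kappa}\ \sum_{\substack{\mu_1\geq1,\dots,\mu_d\geq1\\ \mu_1\lambda_1+\cdots+\mu_d\lambda_d\leq\kappa+1}}\ \sum_{l_{1:1},\dots,l_{1:\mu_1}=1}^m\cdots\sum_{l_{d:1},\dots,l_{d:\mu_d}=1}^m\ \sum_{k_1,\dots,k_M=1}^n\\ &\Bigg[\sum_{\sigma\in\mathfrak{F}_M^{(\mu_1,\lambda_1),\dots,(\mu_d,\lambda_d)}}\ \sum_{\tau\in\mathfrak{S}_\kappa^{M}} \delta_{i_{\tau(1)},\dots,i_{\tau(M)}}^{k_{\sigma(1)},\dots,k_{\sigma(M)}}\;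 \frac{\partial^{\kappa-M+p}\,\mathcal{Y}^j}{\partial x^{i_{\tau(M+1)}}\cdots\partial x^{i_{\tau(\kappa)}}\,\partial y^{l_{1:1}}\cdots\partial y^{l_{d:\mu_d}}}\\ &\ -\sum_{\sigma\in\mathfrak{F}_M^{(\mu_1,\lambda_1),\dots,(\mu_d,\lambda_d)}}\ \sum_{\tau\in\mathfrak{S}_\kappa^{M-1}} \delta_{i_{\tau(1)},\dots,i_{\tau(M-1)}}^{k_{\sigma(1)},\dots,k_{\sigma(M-1)}}\;\delta_{l_{\pi\sigma(M)}}^j\; \frac{\partial^{\kappa-M+p}\,\mathcal{X}^{k_{\sigma(M)}}}{\partial x^{i_{\tau(M)}}\cdots\partial x^{i_{\tau(\kappa)}}\,\partial y^{l_{1:1}}\cdots\widehat{\partial y^{l_{\pi\sigma(M)}}}\cdots\partial y^{l_{d:\mu_d}}}\Bigg]\\ &\cdot\prod_{1\leq\nu_1\leq\mu_1}y_{k_{1:\nu_1:1},\dots,k_{1:\nu_1:\lambda_1}}^{l_{1:\nu_1}}\ \cdots\prod_{1\leq\nu_d\leq\mu_d}y_{k_{d:\nu_d:1},\dots,k_{d:\nu_d:\lambda_d}}^{l_{d:\nu_d}}, \end{aligned} $$ where, in each term, $M:=\mu_1\lambda_1+\cdots+\mu_d\lambda_d$, $p:=\mu_1+\cdots+\mu_d$, the indices $k_1,\dots,k_M$ are also written $k_{e:\nu:\gamma}$ as explained in the context, $\partial y^{l_{1:1}}\cdots\partial y^{l_{d:\mu_d}}$ stands for the $p$ derivatives $\partial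 y^{l_{e:\nu}}$ ($1\leq e\leq d$, $1\leq\nu\leq\mu_e$), and the hat means that the single derivative $\partial y^{l_{\pi\sigma(M)}}$ at position $\pi\sigma(M)$ is omitted.
   Context: $\mathbb{K}=\mathbb{R}$ or $\mathbb{C}$. Independent variables $x^1,\dots,x^n$, dependent variables $y^1,\dots,y^m$. Jet variables and prolongation. The jet coordinates are $x^i,\ y^j,\ y^j_{i_1},\ y^j_{i_1,i_2},\dots$, where $y^j_{i_1,\dots,i_\lambda}$ (with $1\le i_1,\dots,i_\lambda\le n$) is symmetric in its lower indices and otherwise all coordinates are independent. $D_i^\lambda$ is the total differentiation operator $$D_i^\lambda=\frac{\partial}{\partial x^i}+\sum_{j=1}^my_i^j\frac{\partial}{\partial y^j}+\sum_{j=1}^m\sum_{k_1}y^j_{i,k_1}\frac{\partial}{\partial y^j_{k_1}}+\cdots+\sum_{j=1}^m\sum_{k_1,\dots,k_{\lambda-1}}y^j_{i,k_1,\dots,k_{\lambda-1}}\frac{\partial}{\partial y^j_{k_1,\dots,k_{\lambda-1}}},$$ where each distinct jet coordinate is counted once in the sums; i.e. $D_i^\lambda$ is the derivation with $D_i^\lambda x^{i'}=\delta_i^{i'}$, $D_i^\lambda y^j=y^j_i$, $D_i^\lambda y^j_{k_1,\dots,k_q}=y^j_{i,k_1,\dots,k_q}$ for $q\leq\lambda-1$. The coefficients of the $\kappa$-th prolongation are defined inductively by $$\mathbf{Y}^j_{i_1}:=D_{i_1}^1(\mathcal{Y}^j)-\sum_{k=1}^nD_{i_1}^1(\mathcal{X}^k)\,y^j_k,\qquad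 \mathbf{Y}^j_{i_1,\dots,i_\lambda}:=D_{i_\lambda}^\lambda(\mathbf{Y}^j_{i_1,\dots,i_{\lambda-1}})-\sum_{k=1}^nD_{i_\lambda}^1(\mathcal{X}^k)\,y^j_{i_1,\dots,i_{\lambda-1},k}.$$ Index identification. Given integers $1\le\lambda_1<\cdots<\lambda_d$ and $\mu_1,\dots,\mu_d\geq1$, with $M=\sum_e\mu_e\lambda_e$, identify $\{1,\dots,M\}$ with the set of triples $e\!:\!\nu\!:\!\gamma$ ($1\leq e\leq d$, $1\leq\nu\leq\mu_e$, $1\leq\gamma\leq\lambda_e$) by listing the triples in lexicographic order $1\!:\!1\!:\!1,\dots,1\!:\!1\!:\!\lambda_1,\dots,1\!:\!\mu_1\!:\!\lambda_1,\dots,d\!:\!\mu_d\!:\!\lambda_d$. So $k_{e:\nu:\gamma}$ is one of $k_1,\dots,k_M$. The map $\pi$ from the set of triples (hence from $\{1,\dots,M\}$) to the set of pairs $e\!:\!\nu$ is $\pi(e\!:\!\nu\!:\!\gamma):=e\!:\!\nu$; $\pi\sigma(M)$ means $\pi(\sigma(M))$, so that $l_{\pi\sigma(M)}$ is one of the indices $l_{e:\nu}$. Kronecker symbols. $\delta_{i_1,\dots,i_q}^{k_1,\dots,k_q}:=\delta_{i_1}^{k_1}\cdots\delta_{i_q}^{k_q}$ (product of ordinary Kronecker symbols; equal to $1$ if $q=0$), and $\delta_l^j$ is the ordinary Kronecker symbol. Permutations. $\mathfrak{S}_p$ is the full permutation group of $\{1,\dots,p\}$. For $1\leq q\leq p-1$,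 $\mathfrak{S}_p^q$ is the set of $\tau\in\mathfrak{S}_p$ with $\tau(1)<\cdots<\tau(q)$ and $\tau(q+1)<\cdots<\tau(p)$; moreover $\mathfrak{S}_p^0=\mathfrak{S}_p^p=\{\mathrm{id}\}$ and $\mathfrak{S}_p^{p+1}=\emptyset$ (sums over it are $0$). $\mathfrak{H}_M^{(\mu_1,\lambda_1),\dots,(\mu_d,\lambda_d)}$ is the subgroup of those $h\in\mathfrak{S}_M$ which leave the monomial $\prod_{e=1}^d\prod_{\nu=1}^{\mu_e}y_{k_{e:\nu:1},\dots,k_{e:\nu:\lambda_e}}$ (in symmetric-index variables $y_{\dots}$ without upper index) formally unchanged when every $k_\alpha$ is replaced by $k_{h(\alpha)}$; equivalently, for each $e$, $h$ permutes among themselves the $\mu_e$ blocks $\{e\!:\!\nu\!:\!1,\dots,e\!:\!\nu\!:\!\lambda_e\}$, $1\leq\nu\leq\mu_e$. It has cardinality $\mu_1!(\lambda_1!)^{\mu_1}\cdots\mu_d!(\lambda_d!)^{\mu_d}$. $\mathfrak{F}_M^{(\mu_1,\lambda_1),\dots,(\mu_d,\lambda_d)}$ is the quotient of $\mathfrak{S}_M$ by this subgroup; a sum over $\sigma\in\mathfrak{F}_M^{\dots}$ means a sum over a complete set of representatives $\sigma$ of the cosets $\mathfrak{H}\sigma=\{h\circ\sigma:h\in\mathfrak{H}\}$, chosen arbitrarily once and for all (independently of the values of the indices $l$, $k$). *)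

(* Defs.v *)
From HB Require Import structures.
From mathcomp Require Import all_boot all_order all_algebra all_fingroup.
From mathcomp Require Import finmap multiset complex.
From mathcomp Require Import all_classical all_reals all_analysis.
Set Implicit Arguments.
Unset Strict Implicit.
Unset Printing Implicit Defensive.
Import Order.TTheory GRing.Theory Num.Theory.
Import numFieldNormedType.Exports.
Local Open Scope ring_scope.

(* Indices are 0-based throughout: 'I_n stands for {1, ..., n}.               *)

Section BaseSpace.
Variables (K : numFieldType) (n m : nat).

(* A point of K^(n+m) is a row (x^1, ..., x^n, y^1, ..., y^m).  For K = C the
   derivatives are complex ones, so that "smooth" then means holomorphic.     *)
Definition partial (c : 'I_(n + m)) (f : 'rV[K]_(n + m) -> K) :
    'rV[K]_(n + m) -> K :=
  fun p => 'D_(delta_mx 0 c) f p.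

Definition partials (cs : seq 'I_(n + m)) (f : 'rV[K]_(n + m) -> K) :
    'rV[K]_(n + m) -> K :=
  foldr partial f cs.

Definition smooth (f : 'rV[K]_(n + m) -> K) : Prop :=
  forall cs : seq 'I_(n + m),
    continuous (partials cs f) /\
    forall c p, derivable (partials cs f) p (delta_mx 0 c).

Definition partials_xy (xs : seq 'I_n) (ys : seq 'I_m)
    (f : 'rV[K]_(n + m) -> K) : 'rV[K]_(n + m) -> K :=
  partials ([seq lshift m a | a <- xs] ++ [seq rshift n b | b <- ys]) f.

End BaseSpace.

(* [inl i] is x^i and [inr (j, [k_1, ..., k_q])] is y^j_{k_1, ..., k_q}, the
   lower indices forming a multiset because y^j_{...} is symmetric in them;
   q = 0 gives y^j.                                                           *)
Definition jetcoord (n m : nat) := ('I_n + 'I_m * multiset 'I_n)%type.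

(* Points with coordinates of all orders: a function on the jets of order at
   most q is seen as a function of all jet variables which only depends on
   those of order at most q.                                                  *)
Definition jet (K : numFieldType) (n m : nat) := jetcoord n m -> K.

Section Prolongation.
Variables (K : numFieldType) (n m : nat).
Implicit Types (u : jet K n m) (F : jet K n m -> K).

Definition ycoord (j : 'I_m) (ks : seq 'I_n) : jetcoord n m :=
  inr (j, seq_mset ks).

Definition base u : 'rV[K]_(n + m) :=
  row_mx (\row_i u (inl i)) (\row_j u (ycoord j [::])).

Definition jet_partial (c : jetcoord n m) F : jet K n m -> K :=
  fun u =>
    derive1 (fun t : K => F (fun c' => if c' == c then t else u c')) (u c).

Definition multi_indices (q : nat) : seq (multiset 'I_n) :=
  undup [seq seq_mset (val ks) | ks <- enum {: q.-tuple 'I_n}].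

(* D_i^lambda.  The term of order q = 0 in the sum is y^j_i d/dy^j.           *)
Definition total_diff (lambda : nat) (i : 'I_n) F : jet K n m -> K :=
  fun u => jet_partial (inl i) F u
    + \sum_(q < lambda) \sum_(j < m) \sum_(I <- multi_indices q)
        u (inr (j, msetD [mset i]%mset I)) * jet_partial (inr (j, I)) F u.

Variables (X : 'I_n -> 'rV[K]_(n + m) -> K) (Y : 'I_m -> 'rV[K]_(n + m) -> K).

Fixpoint prolong_rev (j : 'I_m) (idx : seq 'I_n) : jet K n m -> K :=
  match idx with
  | [::] => fun u => Y j (base u)
  | i :: idx' => fun u =>
      total_diff (size idx').+1 i (prolong_rev j idx') u
      - \sum_(k < n) total_diff 1 i (fun v => X k (base v)) u
                     * u (ycoord j (rcons (rev idx') k))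
  end.

(* The recursion peels off the last index i_lambda, hence the reversal.       *)
Definition prolong (j : 'I_m) (idx : seq 'I_n) : jet K n m -> K :=
  prolong_rev j (rev idx).

End Prolongation.

(* delta_{i_1, ..., i_q}^{k_1, ..., k_q}, used for lists of equal length.     *)
Definition kronecker (K : numFieldType) (n : nat) (idx ks : seq 'I_n) : K :=
  \prod_(ik <- zip idx ks) (ik.1 == ik.2)%:R.

Definition shuffles (p q : nat) : {set 'S_p} :=
  if (q == 0)%N || (q == p) then [set 1%g]
  else if (q < p)%N then
    [set tau : 'S_p |
       [forall a : 'I_p, forall b : 'I_p,
          (a < b)%N && ((b < q)%N || (q <= a)%N) ==> (tau a < tau b)%N]]
  else finset.set0.

Section IndexIdentification.
Variables (d r s : nat) (lam : {ffun 'I_d -> 'I_r}) (mu : {ffun 'I_d -> 'I_s}).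

Definition weight : nat := (\sum_e mu e * lam e)%N.

(* Pairs e:nu and triples e:nu:gamma; pi is the projection [tag].             *)
Definition block : Type := {e : 'I_d & 'I_(mu e)}.
HB.instance Definition _ := Finite.on block.
Definition triple : Type := {b : block & 'I_(lam (tag b))}.
HB.instance Definition _ := Finite.on triple.

Definition mkblock (e : 'I_d) (nu : 'I_(mu e)) : block :=
  Tagged (fun e => 'I_(mu e)) nu.
Definition mktriple (b : block) (gamma : 'I_(lam (tag b))) : triple :=
  Tagged (fun b : block => 'I_(lam (tag b))) gamma.

Lemma enum_block :
  enum {: block} =
  flatten [seq [seq @mkblock e nu | nu <- enum 'I_(mu e)] | e <- enum 'I_d].
Proof.
rewrite enumT [in LHS]unlock /= /tag_enum -enumT.
by congr flatten; apply: eq_map => e; rewrite enumT.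
Qed.

Lemma enum_triple :
  enum {: triple} =
  flatten [seq [seq @mktriple b gamma | gamma <- enum 'I_(lam (tag b))]
          | b <- enum {: block}].
Proof.
rewrite enumT [in LHS]unlock /= /tag_enum -enumT.
by congr flatten; apply: eq_map => e; rewrite enumT.
Qed.

Lemma card_triple : #|{: triple}| = weight.
Proof.
rewrite cardE enum_triple size_flatten /shape -map_comp sumnE big_map.
rewrite enum_block big_flatten big_map /weight big_enum /=.
apply: eq_bigr => e _; rewrite big_map big_enum /=.
under eq_bigr do rewrite size_map size_enum_ord.
by rewrite sum_nat_const card_ord.
Qed.

(* By [enum_block] and [enum_triple] these follow the lexicographic order.    *)
Definition triple_of (a : 'I_weight) : triple :=
  enum_val (cast_ord (esym card_triple) a).
Definition rank_of (t : triple) : 'I_weight :=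
  cast_ord card_triple (enum_rank t).

Definition block_of (a : 'I_weight) : block := tag (triple_of a).

(* k_{e:nu:1}, ..., k_{e:nu:lambda_e} for b = e:nu.                           *)
Definition lower_indices (T : Type) (k : 'I_weight -> T) (b : block) : seq T :=
  [seq k (rank_of (@mktriple b gamma)) | gamma <- enum 'I_(lam (tag b))].

(* The formal monomial is a commutative product (a multiset) of symbols
   y_{...} which are symmetric in their indices.                              *)
Definition monomial (k : 'I_weight -> 'I_weight) :
    multiset (multiset 'I_weight) :=
  seq_mset [seq seq_mset (lower_indices k b) | b <- enum {: block}].

Definition stab_monomial : {set 'S_weight} :=
  [set h : 'S_weight | monomial h == monomial id].

(* Permutations compose from left to right in the library: h \o sigma is
   sigma * h there, and {h \o sigma | h} is a left coset.                     *)
Definition coset_representatives (S : {set 'S_weight}) : bool :=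
  is_transversal S (lcosets stab_monomial [set: 'S_weight]) [set: 'S_weight].

End IndexIdentification.

(* Main.v *)
Require Import Defs.
From HB Require Import structures.
From mathcomp Require Import all_boot all_order all_algebra all_fingroup.
From mathcomp Require Import finmap multiset complex.
From mathcomp Require Import all_classical all_reals all_analysis.
From mathcomp Require Import ring.
Set Implicit Arguments.
Unset Strict Implicit.
Unset Printing Implicit Defensive.
Import Order.TTheory GRing.Theory Num.Theory.
Import numFieldNormedType.Exports.
Local Open Scope ring_scope.

(* Add to the kappa positions of the indices i_1, ..., i_kappa one more position,
   [None], standing for the summation index of X^k.  The coefficient Y^j_{i_1, ...,
   i_kappa} is a sum over the families P of disjoint nonempty subsets ("blocks") of
   this set of kappa + 1 positions, the block of all the positions being excluded:
   a block B stands for a factor y^l_{i_B}, with a derivative along y^l, and the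
   positions outside all blocks stand for derivatives along the x^i.  If [None]
   lies in a block, the differentiated function is -X^k and this block carries the
   factor y^j_{..., k} without derivative; otherwise the function is Y^j.  Applying
   D_i adds one position, which is left out of all blocks, forms a new block or
   joins an existing one; the term - D_i(X^k) y^j_{..., k} of the recursion supplies
   precisely the families containing the previously excluded block.  The derivatives
   must be reordered, hence the symmetry of second derivatives; over C it follows
   from the mean value theorem applied to real and imaginary parts along real lines.
   On the other side, (lambda, mu) is the type of a family, tau gives the union of
   its blocks, and the coset of sigma gives the way this union is split. *)

(** * Symmetry of second derivatives *)

(** With Q = Y^j - sum_k X^k y^j_k, the coefficient equals D_{i_kappa} ... D_{i_1} Q + sum_k X^k
    y^j_{i_1, ..., i_kappa, k}. The sum over all families, the excluded one included, expands the
    iterated total derivative of Q: for kappa = 0 the two families on the single position [None]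
    give Y^j and - sum_k X^k y^j_k. The excluded family is thus - sum_k X^k y^j_{i_1, ..., i_kappa,
    k}, which explains the bound lambda_e <= kappa. An induction on the stated formula itself would
    have to follow types, cosets and shuffles as kappa grows and to recombine multiplicities;
    families of sets carry no multiplicities, and the induction step becomes a bijection. Another
    obstacle is that [total_diff] rests on derivatives given by a total function and is cut at order
    lambda: derivability along every jet coordinate and a bound on the orders of the variables
    present must be carried along. *)

Section Schwarz.
Context (R : realType) (K : numFieldType) (V : normedModType K).
(* [phi] is the identity if K = R, the real or imaginary part if K = C. *)
Variables (iota : {rmorphism R -> K}) (phi : {additive K -> R}).
Hypotheses (iota_cont : continuous iota) (phi_cont : continuous phi).
Hypothesis phiZ : forall h z, phi (iota h * z) = h * phi z.

(** Since [phi] commutes with multiplication by real scalars, [phi] of the K-difference quotient at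
    [iota h] is a real difference quotient at [h]. This gives access to the real mean value theorem
    for complex K. *)
Lemma is_derive_real_line (f : V -> K) (p v : V) (t : R) :
  derivable f (p + iota t *: v) v ->
  is_derive t 1 (fun s => phi (f (p + iota s *: v)))
            (phi ('D_v f (p + iota t *: v))).
Proof.
move=> df; set q := p + iota t *: v in df *.
have iota0 : (iota @ 0^' --> 0^')%classic.
  have c0 : (iota @ (0 : R) --> (0 : K))%classic.
    by rewrite -[X in (_ --> X)%classic](rmorph0 iota); exact: iota_cont.
  move=> A /c0; apply: (@filterS _ (nbhs (0 : R))) => h Ah h0; apply: Ah.
  by rewrite fmorph_eq0.
have cv := cvg_comp _ _ (cvg_comp _ _ iota0 df) (@phi_cont ('D_v f q)).
suff E : phi \o ((fun h => h^-1 *: ((f \o shift q) (h *: v) - f q)) \o iota) =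
    (fun h : R => h^-1 *:
       (((fun s => phi (f (p + iota s *: v))) \o shift t) (h *: (1 : R))
        - phi (f q))).
  rewrite E in cv.
  by apply: DeriveDef; [exact: cvgP cv | exact: (cvg_lim _ cv)].
apply/funext => h /=.
rewrite -fmorphV [_ *: _]/(_ * _) phiZ raddfB; congr (_ * (phi (f _) - _)).
by rewrite /q addrCA -scalerDl -rmorphD [h *: 1]mulr1.
Qed.

(** Divided by [h * h], this tends to the mixed derivative in either order when h decreases to 0 and
    the mixed derivatives are continuous, while it is symmetric in [a] and [b]. *)
Definition second_difference (f : V -> K) (a b p : V) (h : R) : R :=
  phi (f (p + iota h *: b + iota h *: a)) - phi (f (p + iota h *: a))
  - (phi (f (p + iota h *: b)) - phi (f p)).

Lemma second_differenceC (f : V -> K) (a b p : V) (h : R) :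
  second_difference f a b p h = second_difference f b a p h.
Proof.
have swap (w x y z : R) : w - x - (y - z) = w - y - (x - z) by ring.
rewrite /second_difference swap; congr (phi (f _) - _ - _).
exact: addrAC.
Qed.

(** The mean value theorem is applied twice: along [a] to the difference [G] of the values on two
    parallel lines, then along [b] to the derivative found. The equality is exact, so only the
    location of the intermediate point matters in the limit. *)
Lemma second_difference_mean_value (f : V -> K) (a b p : V) (h : R) :
  (forall q, derivable f q a) -> (forall q, derivable ('D_a f) q b) ->
  0 < h ->
  exists s t, [/\ 0 < s < h, 0 < t < h &
    second_difference f a b p h
    = h * h * phi ('D_b ('D_a f) (p + iota s *: a + iota t *: b))].
Proof.
move=> da dba h0; rewrite /second_difference.
pose G s := phi (f (p + iota h *: b + iota s *: a)) - phi (f (p + iota s *: a)).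
pose G' s := phi ('D_a f (p + iota h *: b + iota s *: a))
             - phi ('D_a f (p + iota s *: a)).
have dG (s : R) : is_derive s 1 G (G' s).
  by apply: is_deriveB; apply: is_derive_real_line.
have cG : {within `[0, h], continuous G}%classic.
  apply: derivable_within_continuous => s _.
  exact: (@ex_derive _ _ _ _ _ _ _ (dG s)).
have [s + E1] := MVT h0 (fun s _ => dG s) cG.
rewrite in_itv /= => hs; rewrite /G rmorph0 !scale0r !addr0 in E1.
rewrite E1 {E1}.
pose H t := phi ('D_a f (p + iota s *: a + iota t *: b)).
pose H' t := phi ('D_b ('D_a f) (p + iota s *: a + iota t *: b)).
have dH (t : R) : is_derive t 1 H (H' t) by apply: is_derive_real_line.
have cH : {within `[0, h], continuous H}%classic.
  apply: derivable_within_continuous => t _.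
  exact: (@ex_derive _ _ _ _ _ _ _ (dH t)).
have [t + E] := MVT h0 (fun t _ => dH t) cH.
rewrite in_itv /= => ht; rewrite /H /H' rmorph0 !scale0r !addr0 in E.
exists s, t; split=> //; rewrite /G' addrAC E; ring.
Qed.

(** Continuity at the corner (0, 0) of the parameter square. Positive parameters suffice, as the
    mean value theorem returns interior points. *)
Lemma near_corner (g : V -> K) (p v w : V) (e : R) :
  continuous g -> 0 < e ->
  exists2 d : R, 0 < d & forall s t, 0 < s < d -> 0 < t < d ->
    `|phi (g p) - phi (g (p + iota s *: v + iota t *: w))| < e.
Proof.
move=> cg e0.
pose Q (st : R * R) := phi (g (p + iota st.1 *: v + iota st.2 *: w)).
have cQ : {for (0, 0), continuous Q}.
  rewrite /Q; apply: continuous_comp => /=; last exact: phi_cont.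
  apply: continuous_comp => /=; last exact: cg.
  apply: cvgD.
    apply: cvgD; first exact: cvg_cst.
    apply: cvgZr_tmp; apply: (cvg_comp _ _ cvg_fst); exact: iota_cont.
  by apply: cvgZr_tmp; apply: (cvg_comp _ _ cvg_snd); exact: iota_cont.
have /cvgrPdist_lt /(_ e e0) := cQ.
rewrite /Q /= rmorph0 !scale0r !addr0.
case=> -[A B] /= [/nbhs_ballP [d1 /= d10 sA] /nbhs_ballP [d2 /= d20 sB]] sAB.
exists (Num.min d1 d2); first by rewrite lt_min d10 d20.
move=> s t /andP[s0 sd] /andP[t0 td]; apply: (sAB (s, t)); split.
  apply: sA; rewrite /ball /= sub0r normrN gtr0_norm // (lt_le_trans sd) //.
  by rewrite ge_min lexx.
apply: sB; rewrite /ball /= sub0r normrN gtr0_norm // (lt_le_trans td) //.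
by rewrite ge_min lexx orbT.
Qed.


Lemma second_difference_limit (f : V -> K) (a b p : V) (e : R) :
  (forall q, derivable f q a) -> (forall q, derivable ('D_a f) q b) ->
  continuous ('D_b ('D_a f)) -> 0 < e ->
  exists2 d : R, 0 < d & forall h, 0 < h < d -> exists2 x,
    second_difference f a b p h = h * h * x &
    `|phi ('D_b ('D_a f) p) - x| < e.
Proof.
move=> da dba cba e0; have [d d0 near_d] := near_corner p a b cba e0.
exists d => // h /andP[h0 hd].
have [s [t [/andP[s0 sh] /andP[t0 th] E]]] :=
  second_difference_mean_value p da dba h0.
exists (phi ('D_b ('D_a f) (p + iota s *: a + iota t *: b))) => //.
by apply: near_d; rewrite ?s0 ?t0 /= (lt_trans _ hd).
Qed.

(** For one small [h], both mixed derivatives lie within [e / 2] of the same number, the second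
    difference divided by [h * h]. *)
Lemma schwarz_projected (f : V -> K) (a b p : V) :
  (forall q, derivable f q a) -> (forall q, derivable f q b) ->
  (forall q, derivable ('D_a f) q b) -> (forall q, derivable ('D_b f) q a) ->
  continuous ('D_b ('D_a f)) -> continuous ('D_a ('D_b f)) ->
  phi ('D_b ('D_a f) p) = phi ('D_a ('D_b f) p).
Proof.
move=> da db dba dab cba cab; apply/eqP; rewrite -subr_eq0 -normr_le0.
apply/ler_addgt0Pr => e e0; rewrite add0r.
have e20 : 0 < e / 2 by rewrite divr_gt0.
have [d1 d10 H1] := second_difference_limit p da dba cba e20.
have [d2 d20 H2] := second_difference_limit p db dab cab e20.
pose h := Num.min d1 d2 / 2.
have h0 : 0 < h by rewrite divr_gt0 // lt_min d10 d20.
have hlt : h < Num.min d1 d2 by rewrite gtr_pMr ?invf_lt1 ?ltr1n // lt_min d10 d20.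
have [|x E1 L1] := H1 h; first by rewrite h0 (lt_le_trans hlt) // ge_min lexx.
have [|y E2 L2] := H2 h; first by rewrite h0 (lt_le_trans hlt) // ge_min lexx orbT.
have Exy : x = y.
  apply: (@mulfI _ (h * h)); first by rewrite mulf_neq0 // gt_eqF.
  by rewrite -E1 -E2; exact: second_differenceC.
rewrite -{}Exy distrC in L2.
by rewrite (splitr e) (le_trans (ler_distD x _ _)) // (ltW (ltrD L1 L2)).
Qed.

End Schwarz.

(** * Real and complex scalars *)

Lemma additive_continuous (K L : numFieldType) (phi : {additive K -> L}) :
  (forall e, 0 < e -> exists2 d, 0 < d & forall z, `|z| < d -> `|phi z| < e) ->
  continuous phi.
Proof.
move=> phi0 z A /nbhs_ballP[e e0 eA]; have [d d0 phid] := phi0 e e0.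
apply/nbhs_ballP; exists d => // w zw; apply: eA.
by rewrite /ball /= -raddfB; exact: phid.
Qed.

Section SchwarzRC.
Context (R : realType) (K : numFieldType).
Hypothesis hK : K = R :> numFieldType \/ K = R[i] :> numFieldType.

Lemma schwarz (V : normedModType K) (f : V -> K) (a b p : V) :
  (forall q, derivable f q a) -> (forall q, derivable f q b) ->
  (forall q, derivable ('D_a f) q b) -> (forall q, derivable ('D_b f) q a) ->
  continuous ('D_b ('D_a f)) -> continuous ('D_a ('D_b f)) ->
  'D_b ('D_a f) p = 'D_a ('D_b f) p.
Proof.
case: hK => EK; move: EK V f a b p => -> V f a b p da db dba dab cba cab.
  by apply: (@schwarz_projected R R V idfun idfun) => // x; exact: cvg_id.
pose C : numFieldType := R[i].
pose iota : {rmorphism R -> C} := real_complex R.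
have iota_cont : continuous (iota : R -> C).
  apply: additive_continuous => e e0.
  have re : e = (complex.Re e)%:C%C.
    by case: e e0 => x y; rewrite ltcE /= => /andP[/eqP ->].
  exists (complex.Re e) => [|t]; first by move: e0; rewrite re ltcR.
  by rewrite re normc_def /= expr0n addr0 sqrtr_sqr ltcR.
(* Both projections are bounded by the modulus, which gives continuity at 0 and, by additivity,
   everywhere. *)
have proj_cont (phi : {additive C -> R}) :
    (forall z, `|phi z|%:C%C <= `|z|) -> continuous phi.
  move=> phi1; apply: additive_continuous => e e0.
  exists (e%:C%C : C) => [|z ze]; first by rewrite ltcR.
  by rewrite -ltcR; apply: le_lt_trans ze.
have Re_cont := proj_cont (@complex.Re R : {additive C -> R}) (@normc_ge_Re R).
have Im1 (z : R[i]) : `|complex.Im z|%:C%C <= `|z|.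
  rewrite normc_def lecR -sqrtr_sqr ler_wsqrtr // lerDr sqr_ge0 //.
have Im_cont := proj_cont (@complex.Im R : {additive C -> R}) Im1.
have ReZ h (z : C) : complex.Re (iota h * z) = h * complex.Re z.
  by case: z => x y /=; rewrite mul0r subr0.
have ImZ h (z : C) : complex.Im (iota h * z) = h * complex.Im z.
  by case: z => x y /=; rewrite mul0r addr0.
apply/eqP; rewrite eq_complex; apply/andP; split; apply/eqP.
  exact: (schwarz_projected iota_cont Re_cont ReZ p da db dba dab cba cab).
exact: (schwarz_projected iota_cont Im_cont ImZ p da db dba dab cba cab).
Qed.

End SchwarzRC.

(** * Reordering iterated partial derivatives *)

Section Partials.
Context (R : realType) (K : numFieldType).
Hypothesis hK : K = R :> numFieldType \/ K = R[i] :> numFieldType.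
Context (n m : nat).
Implicit Types (f : 'rV[K]_(n + m) -> K) (cs : seq 'I_(n + m)).

Lemma partials_cat cs ds f : partials (cs ++ ds) f = partials cs (partials ds f).
Proof. exact: foldr_cat. Qed.

Lemma smooth_partials cs f : smooth f -> smooth (partials cs f).
Proof. by move=> sf ds; rewrite -partials_cat; exact: sf. Qed.

Lemma smooth_partial c f : smooth f -> smooth (partial c f).
Proof. exact: (@smooth_partials [:: c]). Qed.

Lemma smooth_derivable f c p : smooth f -> derivable f p (delta_mx 0 c).
Proof. by move=> sf; have [_] := sf [::]; exact. Qed.

Lemma partialC c d f : smooth f -> partial c (partial d f) = partial d (partial c f).
Proof.
move=> sf; apply/funext => p.
apply: (schwarz hK).
- by move=> q; exact: smooth_derivable.
- by move=> q; exact: smooth_derivable.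
- by move=> q; have [_] := sf [:: d]; exact.
- by move=> q; have [_] := sf [:: c]; exact.
- by have [] := sf [:: c; d].
- by have [] := sf [:: d; c].
Qed.

Lemma partials_partial c cs f : smooth f ->
  partials cs (partial c f) = partial c (partials cs f).
Proof.
move=> sf; elim: cs => //= d cs ->.
by rewrite partialC //; exact: smooth_partials.
Qed.

(** Total derivatives, shuffles and enumerations of blocks list the derivatives in different orders,
    which are reconciled here. Permutations are generated by exchanges of adjacent segments, and a
    segment is moved one derivative at a time. *)
Lemma perm_partials cs ds f :
  perm_eq cs ds -> smooth f -> partials cs f = partials ds f.
Proof.
move=> P sf.
apply: (@catCA_perm_ind _ (fun s => partials cs f = partials s f) _ _ _ P) => //.
move=> s1 s2 s3 ->; rewrite !partials_cat.
elim: s1 => //= c s1 ->; rewrite -partials_partial //.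
by do 2! [exact: smooth_partials || apply: smooth_partials].
Qed.

End Partials.

(** * Total derivatives *)

Lemma seq_mset_nil (T : choiceType) : seq_mset [::] = mset0 :> multiset T.
Proof. by apply/msetP => a; rewrite mset_seqE mset0E. Qed.

Section TotalDerivative.
Context (K : numFieldType) (n m : nat).
Implicit Types (u : jet K n m) (F G : jet K n m -> K) (c : jetcoord n m).

Definition jet_update u c (t : K) : jet K n m :=
  fun c' => if c' == c then t else u c'.

Lemma jet_update_id u c : jet_update u c (u c) = u.
Proof. by apply/funext => c'; rewrite /jet_update; case: eqP => [->|]. Qed.

Lemma mem_multi_indices q (I : multiset 'I_n) :
  (I \in @multi_indices n q) = (size I == q).
Proof.
rewrite mem_undup; apply/mapP/eqP => [[ks _ ->]|sI].
  by rewrite (perm_size (perm_eq_seq_mset _)) size_tuple.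
by exists (Tuple (introT eqP sI)); rewrite ?mem_enum //= seq_mset_id.
Qed.

Definition jet_derivative u F (dF : jetcoord n m -> K) :=
  forall c, is_derive (u c) 1 (fun t => F (jet_update u c t)) (dF c).

Definition total_derivative lambda (i : 'I_n) u (dF : jetcoord n m -> K) : K :=
  dF (inl i) + \sum_(q < lambda) \sum_(j < m) \sum_(I <- multi_indices n q)
                 u (inr (j, msetD [mset i]%mset I)) * dF (inr (j, I)).

(** A relation instead of an equation on [total_diff]: the derivative used there has a value even
    without derivability, whereas the sum and product rules need derivability along every jet
    coordinate. *)
Definition has_total_diff lambda i F u v :=
  exists2 dF, jet_derivative u F dF & total_derivative lambda i u dF = v.

Lemma total_diffE lambda i F u v :
  has_total_diff lambda i F u v -> total_diff lambda i F u = v.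
Proof.
case=> dF hF <-; have E c : jet_partial c F u = dF c.
  by rewrite /jet_partial derive1E; have [_ ->] := hF c.
rewrite /total_diff /total_derivative E; congr (_ + _).
by do 3! [apply: eq_bigr => ? _]; rewrite E.
Qed.

(** Linearity in the family of partial derivatives, in the form from which the rules for sums,
    opposites and products all follow; for products the coefficients are the values at [u]. *)
Lemma total_derivativeD lambda i u (a b : K) dF dG :
  total_derivative lambda i u (fun c => a * dF c + b * dG c) =
  a * total_derivative lambda i u dF + b * total_derivative lambda i u dG.
Proof.
rewrite /total_derivative !mulrDr addrACA; congr (_ + _).
do 3! [rewrite !big_distrr -big_split; apply: eq_bigr => ? _] => /=.
by rewrite mulrDr !(mulrCA _ a) !(mulrCA _ b).
Qed.

Lemma has_total_diff_eq lambda i F u v w :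
  has_total_diff lambda i F u v -> v = w -> has_total_diff lambda i F u w.
Proof. by move=> ? <-. Qed.

Lemma has_total_diff0 lambda i u : has_total_diff lambda i (fun=> 0) u 0.
Proof.
exists (fun=> 0) => [c|]; first exact: is_derive_cst.
by rewrite /total_derivative; do 3! [rewrite big1 ?addr0 // => ? _]; rewrite mulr0.
Qed.

Lemma has_total_diffD lambda i F G u v w :
  has_total_diff lambda i F u v -> has_total_diff lambda i G u w ->
  has_total_diff lambda i (fun u => F u + G u) u (v + w).
Proof.
case=> [dF hF <-] [dG hG <-]; exists (fun c => 1 * dF c + 1 * dG c) => [c|].
  by rewrite !mul1r; apply: is_deriveD.
by rewrite total_derivativeD !mul1r.
Qed.

Lemma has_total_diffN lambda i F u v :
  has_total_diff lambda i F u v -> has_total_diff lambda i (fun u => - F u) u (- v).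
Proof.
case=> [dF hF <-]; exists (fun c => (-1) * dF c + 0 * dF c) => [c|].
  by rewrite mulN1r mul0r addr0; apply: is_deriveN.
by rewrite total_derivativeD mulN1r mul0r addr0.
Qed.

Lemma has_total_diffM lambda i F G u v w :
  has_total_diff lambda i F u v -> has_total_diff lambda i G u w ->
  has_total_diff lambda i (fun u => F u * G u) u (v * G u + F u * w).
Proof.
case=> [dF hF <-] [dG hG <-].
exists (fun c => G u * dF c + F u * dG c) => [c|].
  rewrite addrC; have := is_deriveM (hF c) (hG c).
  by rewrite /= jet_update_id.
by rewrite total_derivativeD (mulrC (G u)).
Qed.

Lemma has_total_diff_sum lambda i u (J : Type) (r : seq J) (P : pred J)
    (F : J -> jet K n m -> K) (v : J -> K) :
  (forall a, P a -> has_total_diff lambda i (F a) u (v a)) ->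
  has_total_diff lambda i (fun u => \sum_(a <- r | P a) F a u) u
    (\sum_(a <- r | P a) v a).
Proof.
move=> hF; elim: r => [|a r IH].
  rewrite big_nil; under eq_fun do rewrite big_nil.
  exact: has_total_diff0.
rewrite big_cons; under eq_fun do rewrite big_cons.
by case: ifP => // Pa; apply: has_total_diffD; first exact: hF.
Qed.

(** The size bound reflects the truncation of D_i^lambda: the term that differentiates along this
    very coordinate must occur in the sum. All other terms vanish. *)
Lemma has_total_diff_coord lambda i (l : 'I_m) (I : multiset 'I_n) u :
  (size I < lambda)%N ->
  has_total_diff lambda i (fun u => u (inr (l, I))) u
    (u (inr (l, msetD [mset i]%mset I))).
Proof.
move=> sI; exists (fun c => (inr (l, I) == c)%:R) => [c|].
  rewrite /jet_update; case: eqP => _; [exact: is_derive_id|exact: is_derive_cst].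
rewrite /total_derivative add0r (bigD1 (Ordinal sI)) //= [X in _ + X]big1 ?addr0.
  rewrite (bigD1 l) //= [X in _ + X]big1 ?addr0.
    rewrite (bigD1_seq I) /= ?undup_uniq ?mem_multi_indices //.
    rewrite eqxx mulr1 big1 ?addr0 // => I' /negPf neI.
    by rewrite (inj_eq inr_inj) xpair_eqE [I == _]eq_sym neI andbF mulr0.
  move=> l' /negPf nel; apply: big1 => I' _.
  by rewrite (inj_eq inr_inj) xpair_eqE [l == _]eq_sym nel mulr0.
move=> q /negPf neq; apply: big1 => l' _; rewrite big_seq big1 // => I'.
rewrite mem_multi_indices => /eqP sI'.
rewrite (inj_eq inr_inj) xpair_eqE; case: (I =P I') => [E|]; last by rewrite andbF mulr0.
by case/eqP: neq; apply: val_inj; rewrite /= -sI' -E.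
Qed.

Lemma base_update_x u i t :
  base (jet_update u (inl i) t) = base u + (t - u (inl i)) *: delta_mx 0 (lshift m i).
Proof.
apply/rowP => k; rewrite !mxE.
case: split_ordP => k' ->; rewrite !mxE /jet_update /= ?eq_lshift ?eq_rlshift.
  rewrite (inj_eq inl_inj); case: eqP => [->|_]; last by rewrite mulr0 addr0.
  by rewrite mulr1 addrC subrK.
by rewrite mulr0 addr0.
Qed.

(** Only the empty multiset designates y^j itself; a change of a higher coordinate leaves the base
    point where it is. *)
Lemma base_update_y u (j : 'I_m) (I : multiset 'I_n) t :
  base (jet_update u (inr (j, I)) t) =
    base u + (if I == mset0 then (t - u (inr (j, I))) else 0) *: delta_mx 0 (rshift n j).
Proof.
apply/rowP => k; rewrite !mxE.
case: split_ordP => k' ->; rewrite !mxE /jet_update /= ?eq_lrshift ?eq_rshift.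
  by rewrite mulr0 addr0.
rewrite /ycoord (inj_eq inr_inj) xpair_eqE seq_mset_nil [mset0 == _]eq_sym.
case: (I =P mset0) => [->|_]; last by rewrite andbF mul0r addr0.
rewrite andbT; case: eqP => [->|_]; last by rewrite mulr0 addr0.
by rewrite mulr1 addrC subrK.
Qed.

Lemma has_total_diff_base lambda i (f : 'rV[K]_(n + m) -> K) u :
  (0 < lambda)%N -> smooth f ->
  has_total_diff lambda i (fun u => f (base u)) u
    (partial (lshift m i) f (base u) +
     \sum_(l < m) partial (rshift n l) f (base u) * u (inr (l, [mset i]%mset))).
Proof.
move=> l0 sf.
have line (c : 'I_(n + m)) (a : K) :
    is_derive a 1 (fun t => f (base u + (t - a) *: delta_mx 0 c)) (partial c f (base u)).
  have [_ /(_ c (base u)) df] := sf [::].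
  suff E : (fun h : K => h^-1 *:
       (((fun t => f (base u + (t - a) *: delta_mx 0 c)) \o shift a) (h *: (1 : K)) - f (base u + (a - a) *: delta_mx 0 c))) =
     (fun h => h^-1 *: ((f \o shift (base u)) (h *: delta_mx 0 c) - f (base u))).
    by apply: DeriveDef; rewrite /derivable /derive E.
  apply/funext => h /=; rewrite subrr scale0r addr0 addrK [h *: 1]mulr1.
  by rewrite (addrC (base u)).
exists (fun c => match c with
  | inl k => partial (lshift m k) f (base u)
  | inr (l, J) => if J == mset0 then partial (rshift n l) f (base u) else 0 end).
  case=> [k|[l I]].
    have -> : (fun t => f (base (jet_update u (inl k) t))) =
       (fun t => f (base u + (t - u (inl k)) *: delta_mx 0 (lshift m k))).
      by apply/funext => t; rewrite base_update_x.
    exact: line.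
  have -> : (fun t => f (base (jet_update u (inr (l, I)) t))) =
     (fun t => f (base u + (if I == mset0 then t - u (inr (l, I)) else 0) *:
                  delta_mx 0 (rshift n l))).
    by apply/funext => t; rewrite base_update_y.
  case: eqP => _; first exact: line.
  exact: is_derive_cst.
rewrite /total_derivative; congr (_ + _).
(* Only the order q = 0 contributes, and it is present because lambda is positive. *)
case: lambda l0 => // lambda _; rewrite big_ord_recl [X in _ + X]big1 ?addr0; last first.
  move=> q _; apply: big1 => l _; rewrite big_seq big1 // => I.
  by rewrite mem_multi_indices -size_mset_eq0 => /eqP ->; rewrite mulr0.
apply: eq_bigr => l _; rewrite (bigD1_seq mset0) /= ?undup_uniq ?mem_multi_indices //.
  rewrite eqxx msetD0 mulrC big1 ?addr0 // => I /negPf ->.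
  by rewrite mulr0.
by rewrite size_mset0.
Qed.

End TotalDerivative.

(** * Sums over the dependent indices *)

Section JetSum.
Context (R : realType) (K : numFieldType).
Hypothesis hK : K = R :> numFieldType \/ K = R[i] :> numFieldType.
Context (n m : nat).
Implicit Types (f : 'rV[K]_(n + m) -> K) (u : jet K n m).
Implicit Types (Bs : seq (multiset 'I_n)).

(** In closed form: the sum, over all choices of a dependent index l_B for each B, of the derivative
    of f along the y^{l_B} times the product of the y^{l_B}_B. Peeling off one factor at a time lets
    the Leibniz rule go by induction; [sum_ffun_jet_sum] gives the closed form. *)
Fixpoint jet_sum f Bs u : K :=
  if Bs is B :: Bs' then
    \sum_(l < m) jet_sum (partial (rshift n l) f) Bs' u * u (inr (l, B))
  else f (base u).

Lemma jet_sum_catCA f Bs B Cs u : smooth f ->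
  jet_sum f (Bs ++ B :: Cs) u = jet_sum f (B :: Bs ++ Cs) u.
Proof.
elim: Bs f => //= A Bs IH f sf.
transitivity (\sum_(l < m) \sum_(l' < m)
   jet_sum (partial (rshift n l') (partial (rshift n l) f)) (Bs ++ Cs) u *
      u (inr (l', B)) * u (inr (l, A))).
  by apply: eq_bigr => l _; rewrite IH ?mulr_suml //; exact: smooth_partial.
rewrite exchange_big; apply: eq_bigr => l' _; rewrite mulr_suml.
by apply: eq_bigr => l _; rewrite (partialC hK) // mulrAC.
Qed.

Lemma perm_jet_sum f Bs Cs u : perm_eq Bs Cs -> smooth f ->
  jet_sum f Bs u = jet_sum f Cs u.
Proof.
elim: Bs Cs f => [|B Bs IH] Cs f P sf.
  by move: P; rewrite perm_sym => /perm_nilP ->.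
have BC : B \in Cs by rewrite -(perm_mem P) mem_head.
case/splitPr: BC P => C1 C2.
rewrite perm_sym (perm_catCA C1 [:: B] C2) perm_cons perm_sym => P.
rewrite jet_sum_catCA //=; apply: eq_bigr => l _; congr (_ * _).
by apply: IH => //; exact: smooth_partial.
Qed.

(** The three groups of terms come from differentiating f along x^i, f along some y^l, which creates
    the factor y^l_i, and one of the existing factors. Factors are labelled by the elements of [s],
    since different labels may carry equal multisets. *)
Lemma has_total_diff_jet_sum lambda i f (T : eqType) (g : T -> multiset 'I_n)
    (s : seq T) u :
  smooth f -> uniq s -> (0 < lambda)%N ->
  (forall B, B \in s -> size (g B) < lambda)%N ->
  has_total_diff lambda i (jet_sum f (map g s)) u
    (jet_sum (partial (lshift m i) f) (map g s) u
     + jet_sum f ([mset i]%mset :: map g s) u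
     + \sum_(B <- s) jet_sum f (msetD [mset i]%mset (g B) :: map g (rem B s)) u).
Proof.
move=> + + l0; elim: s f => [|B0 s IH] f sf.
  by move=> _ _; rewrite big_nil addr0; exact: has_total_diff_base.
rewrite cons_uniq => /andP[nB0 us] gs.
apply: has_total_diff_eq.
  apply: has_total_diff_sum => l _; apply: has_total_diffM.
    apply: IH => //; first exact: smooth_partial.
    by move=> B Bs; apply: gs; rewrite inE Bs orbT.
  by apply: has_total_diff_coord; apply: gs; rewrite mem_head.
have E1 : \sum_(l < m) jet_sum (partial (lshift m i) (partial (rshift n l) f)) (map g s) u
      * u (inr (l, g B0)) =
    jet_sum (partial (lshift m i) f) (map g (B0 :: s)) u.
  by apply: eq_bigr => l _; rewrite (partialC hK).
have E2 : \sum_(l < m) jet_sum (partial (rshift n l) f) ([mset i]%mset :: map g s) u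
      * u (inr (l, g B0)) =
    jet_sum f ([mset i]%mset :: map g (B0 :: s)) u.
  exact: (@jet_sum_catCA f [:: g B0] [mset i]%mset (map g s) u sf).
have E3 : \sum_(l < m) (\sum_(B <- s) jet_sum (partial (rshift n l) f)
        (msetD [mset i]%mset (g B) :: map g (rem B s)) u) * u (inr (l, g B0)) =
    \sum_(B <- s) jet_sum f (msetD [mset i]%mset (g B) :: map g (rem B (B0 :: s))) u.
  under eq_bigr do rewrite mulr_suml.
  rewrite exchange_big !big_seq; apply: eq_bigr => B Bs /=.
  have -> : (B0 == B) = false by apply: contraNF nB0 => /eqP ->.
  exact: (@jet_sum_catCA f [:: g B0] (msetD [mset i]%mset (g B)) (map g (rem B s)) u sf).
have rem_head : rem B0 (B0 :: s) = s by rewrite /= eqxx.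
rewrite big_cons rem_head -E1 -E2 -E3.
under eq_bigr do rewrite 2!mulrDl.
rewrite !big_split /= -!addrA; congr (_ + (_ + _)); exact: addrC.
Qed.

(** The weights [w] concern the labels outside [s]. They are absent when [s] lists all blocks, as
    for Y^j; for X^k one block is left out, and its weight is the Kronecker symbol of its dependent
    index times its jet variable. *)
Lemma sum_ffun_jet_sum (T : finType) (g : T -> multiset 'I_n) (s : seq T) f
    (w : T -> 'I_m -> K) u : smooth f -> uniq s ->
  \sum_(l : {ffun T -> 'I_m})
    partials [seq rshift n (l b) | b <- s] f (base u)
    * \prod_(b <- s) u (inr (l b, g b)) * \prod_(b | b \notin s) w b (l b)
  = jet_sum f (map g s) u * \prod_(b | b \notin s) \sum_(l < m) w b l.
Proof.
elim: s f w => [|b0 s IH] f w sf /=.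
  move=> _; rewrite bigA_distr_bigA big_distrr /=; apply: eq_bigr => l _.
  by rewrite big_nil mulr1.
move=> /andP[nb0 us].
rewrite mulr_suml.
(* The label [b0] leaves the list and receives as weight the indicator of the value l', so that the
   induction hypothesis for general weights applies. *)
pose w' l' b l := if b == b0 then (l == l')%:R else w b l.
transitivity (\sum_(l' < m) u (inr (l', g b0)) *
   \sum_(l : {ffun T -> 'I_m})
    partials [seq rshift n (l b) | b <- s] (partial (rshift n l') f) (base u)
    * \prod_(b <- s) u (inr (l b, g b)) * \prod_(b | b \notin s) w' l' b (l b)).
  under [RHS]eq_bigr do rewrite big_distrr.
  rewrite exchange_big /=; apply: eq_bigr => l _.
  rewrite (bigD1 (l b0)) //= [X in _ = _ + X]big1 ?addr0.
    rewrite (partials_partial hK) // big_cons [in RHS](bigD1 b0) //=.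
    rewrite /w' eqxx eqxx mul1r [RHS]mulrA [in RHS]mulrA; congr (_ * _).
      rewrite mulrA; congr (_ * _); exact: mulrC.
    apply: eq_big => b; first by rewrite inE negb_or andbC.
    by rewrite inE negb_or => /andP[/negPf ->].
  move=> l' /negPf nl; rewrite [X in _ * (_ * X)](bigD1 b0) //= /w' eqxx eq_sym nl.
  by rewrite mul0r !mulr0.
apply: eq_bigr => l' _; rewrite IH //; last exact: smooth_partial.
rewrite mulrA (mulrC (u _)); congr (_ * _).
rewrite (bigD1 b0) //= [X in X * _](_ : _ = 1) ?mul1r.
  apply: eq_big => b; first by rewrite inE negb_or andbC.
  by move=> /andP[_ /negPf nb]; apply: eq_bigr => l _; rewrite /w' nb.
by rewrite /w' eqxx (bigD1 l') //= eqxx big1 ?addr0 // => l /negPf ->.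
Qed.

End JetSum.

(** * Partial partitions of a finite set *)

Section PartialPartition.
Import mathcomp.boot.fintype mathcomp.boot.finset.
Context (T : finType).
Implicit Types (A B C : {set T}) (P Q : {set {set T}}) (x : T).

Definition partial_partition A P :=
  [&& trivIset P, set0 \notin P & cover P \subset A].

Lemma partial_partitionP A P :
  reflect [/\ forall B C x, B \in P -> C \in P -> x \in B -> x \in C -> B = C,
              forall B, B \in P -> exists x, x \in B &
              forall B, B \in P -> B \subset A]
          (partial_partition A P).
Proof.
apply: (iffP and3P) => [[tP P0 cP]|[tP P0 cP]]; split.
- move=> B C x BP CP xB xC; apply: contraTeq xC => neq.
  by have /trivIsetP /(_ B C BP CP neq) /disjointFr -> := tP.
- move=> B BP; apply/set0Pn; apply: contraNneq P0 => <-; exact: BP.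
- by move=> B BP; apply: subset_trans cP; exact: bigcup_sup.
- apply/trivIsetP => B C BP CP; apply: contraNT => /pred0Pn[x /andP[xB xC]].
  by apply/eqP; exact: (tP B C x).
- by apply/negP => /P0[x]; rewrite inE.
- by apply/bigcupsP.
Qed.

Lemma partial_partition_pblock A P B x :
  partial_partition A P -> B \in P -> x \in B -> pblock P x = B.
Proof. by case/and3P => tP _ _; exact: def_pblock. Qed.

Definition extend_block x B P := (x |: B) |: (P :\ B).

Lemma in_extend_block x B P C :
  (C \in extend_block x B P) = (C == x |: B) || (C != B) && (C \in P).
Proof. by rewrite !inE. Qed.

Section Fresh.
Context (A : {set T}) (x : T).
Hypothesis xA : x \notin A.

Lemma partial_partition_fresh Q B : partial_partition A Q -> B \in Q -> x \notin B.
Proof.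
by case/partial_partitionP => _ _ QA /QA /subsetP BA; apply: contra xA; exact: BA.
Qed.

Lemma partial_partition_unused P :
  partial_partition (x |: A) P && (x \notin cover P) = partial_partition A P.
Proof.
rewrite /partial_partition -!andbA; do 2! congr (_ && _).
apply/andP/idP => [[/subsetP PA xP]|PA].
  apply/subsetP => y yP; move: (PA y yP); rewrite in_setU1.
  by case: eqP yP xP => // -> ->.
split; first by apply: subset_trans PA (subsetUr _ _).
by apply: contra xA; apply/subsetP.
Qed.

Lemma partial_partition_singleton Q : partial_partition A Q ->
  partial_partition (x |: A) ([set x]%SET |: Q) /\ [set x]%SET \notin Q.
Proof.
move=> pQ; have xQ := partial_partition_fresh pQ.
have nQ : [set x]%SET \notin Q by apply/negP => /xQ; rewrite set11.
split=> //; case/partial_partitionP: pQ => tQ Q0 QA.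
apply/partial_partitionP; split.
- move=> B C y; rewrite !in_setU1 => /orP[/eqP ->|BQ] /orP[/eqP ->|CQ] //.
  + by rewrite inE => /eqP ->; rewrite (negPf (xQ _ CQ)).
  + by move=> yB; rewrite inE => /eqP E; move: yB; rewrite E (negPf (xQ _ BQ)).
  + exact: tQ.
- move=> B; rewrite in_setU1 => /orP[/eqP ->|/Q0 //].
  by exists x; rewrite set11.
- move=> B; rewrite in_setU1 => /orP[/eqP ->|/QA BA].
    by rewrite sub1set setU11.
  by apply: subset_trans BA (subsetUr _ _).
Qed.

Lemma partial_partition_remove P : partial_partition (x |: A) P -> [set x]%SET \in P ->
  partial_partition A (P :\ [set x]%SET).
Proof.
case/partial_partitionP => tP P0 PA xP; apply/partial_partitionP; split.
- move=> B C y; rewrite !inE => /andP[_ BP] /andP[_ CP]; exact: tP.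
- by move=> B; rewrite inE => /andP[_ /P0].
- move=> B; rewrite !inE => /andP[Bx BP]; apply/subsetP => y yB.
  have := subsetP (PA B BP) y yB; rewrite in_setU1 => /orP[/eqP E|//].
  case/eqP: Bx; apply: (tP _ _ x) => //; rewrite ?set11 // -E //.
Qed.

Lemma partial_partition_extend Q B : partial_partition A Q -> B \in Q ->
  [/\ partial_partition (x |: A) (extend_block x B Q),
      [set x]%SET \notin extend_block x B Q & x \in cover (extend_block x B Q)].
Proof.
move=> pQ BQ; have xQ := partial_partition_fresh pQ.
case/partial_partitionP: pQ => tQ Q0 QA; split.
- apply/partial_partitionP; split.
  + move=> C D y; rewrite !in_extend_block.
    move=> /orP[/eqP ->|/andP[CB CQ]] /orP[/eqP ->|/andP[DB DQ]] //.
    * rewrite in_setU1 => /orP[/eqP ->|yB yD]; first by rewrite (negPf (xQ _ DQ)).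
      by case/eqP: DB; exact: (tQ _ _ y).
    * rewrite in_setU1 => yC /orP[/eqP E|yB]; first by move: yC; rewrite E (negPf (xQ _ CQ)).
      by case/eqP: CB; exact: (tQ _ _ y).
    * exact: tQ.
  + move=> C; rewrite in_extend_block => /orP[/eqP ->|/andP[_ /Q0//]].
    by exists x; rewrite setU11.
  + move=> C; rewrite in_extend_block => /orP[/eqP ->|/andP[_ /QA CA]].
      by apply: setUS; exact: QA.
    by apply: subset_trans CA (subsetUr _ _).
- rewrite in_extend_block negb_or negb_and; apply/andP; split.
    have [y yB] := Q0 B BQ; apply/eqP => /setP /(_ y).
    rewrite !inE yB orbT => /eqP E.
    by have := xQ _ BQ; rewrite -E yB.
  apply/orP; right; apply/negP => /xQ; by rewrite set11.
- by apply/bigcupP; exists (x |: B); rewrite ?setU11 // in_extend_block eqxx.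
Qed.

Lemma extend_blockK Q B : partial_partition A Q -> B \in Q ->
  let C := pblock (extend_block x B Q) x in
  C :\ x = B /\ (C :\ x) |: (extend_block x B Q :\ C) = Q.
Proof.
move=> pQ BQ; have [pE _ _] := partial_partition_extend pQ BQ.
have xQ := partial_partition_fresh pQ.
have -> : pblock (extend_block x B Q) x = x |: B.
  by apply: (partial_partition_pblock pE); rewrite ?setU11 // in_extend_block eqxx.
have BE : (x |: B) :\ x = B by rewrite setU1K // xQ.
split=> //=; rewrite BE /extend_block setU1K ?setD1K //.
by rewrite !inE negb_and; apply/orP; right; apply/negP => /xQ; rewrite setU11.
Qed.

(** Taking x out of its block inverts [extend_block]. As x is not alone, the rest of its block is
    nonempty; by disjointness this rest is not already another block, so no two blocks are
    merged. *)
Lemma partial_partition_shrink P (C := pblock P x) (Q := (C :\ x) |: (P :\ C)) :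
  partial_partition (x |: A) P -> x \in cover P -> [set x]%SET \notin P ->
  [/\ partial_partition A Q, C :\ x \in Q & extend_block x (C :\ x) Q = P].
Proof.
move=> /[dup] /and3P[tr _ _] /partial_partitionP[tP P0 PA] xcP xP.
have CP : C \in P by exact: pblock_mem.
have xC : x \in C by rewrite mem_pblock.
have [y yC yx] : exists2 y, y \in C & y != x.
  case: (pickP [pred y | (y \in C) && (y != x)]) => [y /andP[]|C0]; first by exists y.
  case/negP: xP; rewrite (_ : [set x]%SET = C) //; apply/setP => z.
  have := C0 z; rewrite /= inE; case: (z =P x) => [-> _|_]; first by rewrite xC.
  by rewrite andbT => ->.
have yB : y \in C :\ x by rewrite !inE yx.
have BP : (C :\ x) \notin P :\ C.
  rewrite !inE negb_and negbK; have [//|neq /=] := boolP (C :\ x == C).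
  by apply: contra neq => BP; apply/eqP; exact: (tP _ _ y).
split.
- apply/partial_partitionP; split.
  + move=> D E z; rewrite /Q !in_setU1 ![_ \in P :\ C]inE.
    rewrite !(in_set1, inE).
    move=> /orP[/eqP ->|/andP[DC DP]] /orP[/eqP ->|/andP[EC EP]] //.
    * by rewrite in_setD1 => /andP[_ zC] zE; case/eqP: EC; exact: (tP _ _ z).
    * by rewrite in_setD1 => zD /andP[_ zC]; case/eqP: DC; exact: (tP _ _ z).
    * exact: tP.
  + move=> D; rewrite in_setU1 => /orP[/eqP ->|]; first by exists y.
    by rewrite in_setD1 => /andP[_ /P0].
  + move=> D; rewrite in_setU1 => DQ; apply/subsetP => z zD.
    have zx : z != x.
      case/orP: DQ zD => [/eqP ->|]; first by rewrite in_setD1 => /andP[].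
      rewrite in_setD1 => /andP[DC DP] zD; apply: contra DC => /eqP E.
      by apply/eqP; apply: (tP _ _ x) => //; rewrite -E.
    have : z \in x |: A.
      case/orP: DQ zD => [/eqP ->|].
        by rewrite in_setD1 => /andP[_]; exact: (subsetP (PA C CP)).
      by rewrite in_setD1 => /andP[_ DP]; exact: (subsetP (PA D DP)).
    by rewrite in_setU1 (negPf zx).
- by rewrite setU11.
- by rewrite /extend_block setD1K // /Q setU1K // setD1K.
Qed.

(** Families are sorted by the status of x: outside all blocks, alone in its block, or together with
    others. In the last case removing x recovers both Q and the block that x joined. The right-hand
    side has the shape of the Leibniz rule. *)
Lemma sum_partial_partition (V : nmodType) (Phi : {set {set T}} -> V) :
  \sum_(P | partial_partition (x |: A) P) Phi P =
  \sum_(Q | partial_partition A Q)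
     (Phi Q + Phi ([set x]%SET |: Q) + \sum_(B in Q) Phi (extend_block x B Q)).
Proof.
rewrite !big_split /= (bigID (fun P => x \notin cover P)) /= -addrA; congr (_ + _).
  by apply: eq_bigl => P; rewrite partial_partition_unused.
rewrite (bigID (fun P => [set x]%SET \in P)) /=; congr (_ + _).
  rewrite (reindex_onto (fun Q => [set x]%SET |: Q) (fun P => P :\ [set x]%SET)) /=; last first.
    by move=> P /andP[_ xP]; rewrite setD1K.
  apply: eq_bigl => Q; apply/idP/idP.
    move=> /andP[/andP[/andP[pP _] xP] /eqP E].
    by rewrite -E; exact: partial_partition_remove.
  move=> pQ; have [pP nQ] := partial_partition_singleton pQ.
  rewrite pP setU1K // eqxx setU11 negbK !andbT.
  by apply/bigcupP; exists [set x]%SET; rewrite ?setU11 ?set11.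
rewrite pair_big_dep /=.
rewrite (reindex_onto (fun QB : {set {set T}} * {set T} => extend_block x QB.2 QB.1)
   (fun P => ((pblock P x :\ x) |: (P :\ pblock P x), pblock P x :\ x))) /=; last first.
  move=> P /andP[/andP[pP]]; rewrite negbK => xP nP.
  by have [] := partial_partition_shrink pP xP nP.
apply: eq_bigl => -[Q B] /=; apply/idP/idP.
  move=> /andP[/andP[/andP[pP]]]; rewrite negbK => xP nP /eqP[E1 E2].
  by have [] := partial_partition_shrink pP xP nP; rewrite E1 E2 => -> ->.
move=> /andP[pQ BQ]; have [-> -> ->] := partial_partition_extend pQ BQ.
by have [E1 E2] := extend_blockK pQ BQ; apply/eqP; rewrite E2 E1.
Qed.

End Fresh.
End PartialPartition.

(** * The prolongation as a sum over partial partitions *)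

Section ProlongationExpansion.
Import mathcomp.boot.fintype mathcomp.boot.finset.
Context (R : realType) (K : numFieldType).
Hypothesis hK : K = R :> numFieldType \/ K = R[i] :> numFieldType.
Context (n m : nat) (T : finType).
Implicit Types (f : 'rV[K]_(n + m) -> K) (u : jet K n m).
Implicit Types (A B C : {set T}) (P Q : {set {set T}}) (x : T) (h : T -> 'I_n).

Definition block_mset h B : multiset 'I_n := seq_mset [seq h t | t <- enum B].

Lemma block_mset_setU1 h x B : x \notin B ->
  block_mset h (x |: B) = msetD [mset h x]%mset (block_mset h B).
Proof.
move=> xB; rewrite /block_mset -mset_cons -[h x :: _]/([seq h t | t <- x :: enum B]).
apply/eq_seq_msetP/perm_map/uniq_perm; rewrite ?enum_uniq //= ?mem_enum ?xB ?enum_uniq //.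
by move=> y; rewrite mem_enum !inE mem_enum.
Qed.

Lemma block_mset_set1 h x : block_mset h [set x] = [mset h x]%mset.
Proof.
rewrite -[[set x]]setU0 block_mset_setU1 ?inE // /block_mset enum_set0.
by rewrite seq_mset_nil msetD0.
Qed.

Lemma size_block_mset h B : size (block_mset h B) = #|B|.
Proof. by rewrite (perm_size (perm_eq_seq_mset _)) size_map -cardE. Qed.

Definition blocks_sum f h P u := jet_sum f [seq block_mset h B | B <- enum P] u.

Lemma perm_enum_setU1 P B : B \notin P -> perm_eq (enum (B |: P)) (B :: enum P).
Proof.
move=> BP; apply: uniq_perm; rewrite ?enum_uniq //= ?mem_enum ?BP ?enum_uniq //.
by move=> C; rewrite mem_enum !inE mem_enum.
Qed.

Lemma has_total_diff_blocks_sum lambda A x f h P u :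
  smooth f -> (0 < lambda)%N -> partial_partition A P -> x \notin A ->
  (forall B, B \in P -> #|B| < lambda)%N ->
  has_total_diff lambda (h x) (blocks_sum f h P) u
    (blocks_sum (partial (lshift m (h x)) f) h P u + blocks_sum f h ([set x] |: P) u
     + \sum_(B in P) blocks_sum f h (extend_block x B P) u).
Proof.
move=> sf l0 pP xA sP; apply: has_total_diff_eq.
  apply: (@has_total_diff_jet_sum _ _ hK n m lambda (h x) f _ (block_mset h) (enum P) u sf
      (enum_uniq _) l0) => B.
  by rewrite mem_enum size_block_mset; exact: sP.
have xP := partial_partition_fresh xA pP.
congr (_ + _ + _).
  have nP : [set x] \notin P by apply/negP => /xP; rewrite set11.
  rewrite /blocks_sum (perm_jet_sum hK _ (perm_map _ (perm_enum_setU1 nP)) sf).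
  by rewrite /= block_mset_set1.
rewrite big_enum_cond /=; apply: eq_big => B; first by rewrite andbT.
rewrite andbT => BP.
have nP : x |: B \notin P :\ B.
  by rewrite !inE negb_and; apply/orP; right; apply/negP => /xP; rewrite setU11.
rewrite /blocks_sum /extend_block (perm_jet_sum hK _ (perm_map _ (perm_enum_setU1 nP)) sf).
rewrite /= block_mset_setU1 ?xP //; apply: eq_bigr => l _; congr (_ * _).
apply: (perm_jet_sum hK); last exact: smooth_partial.
apply: perm_map; apply: uniq_perm; rewrite ?rem_uniq ?enum_uniq //.
by move=> C; rewrite mem_rem_uniq ?enum_uniq // mem_enum !inE mem_enum.
Qed.

Context (X : 'I_n -> 'rV[K]_(n + m) -> K) (Y : 'I_m -> 'rV[K]_(n + m) -> K).
Hypotheses (hX : forall k, smooth (X k)) (hY : forall j, smooth (Y j)).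
Context (j : 'I_m) (star : T) (idx : T -> 'I_n).

Definition idx_at (k : 'I_n) (t : T) := if t == star then k else idx t.

Definition x_partials (s : seq T) P f :=
  partials [seq lshift m (idx t) | t <- s & t \notin cover P] f.

(* The block containing [star] belongs to the factor y^j_{S,k}, whose last index
   k is the value at [star]; the other blocks come from the derivatives of Y^j or
   X^k along the y^l. *)
Definition prolong_term (s : seq T) P u : K :=
  if star \in cover P then
    - \sum_(k < n) blocks_sum (x_partials s P (X k)) (idx_at k) (P :\ pblock P star) u
                   * u (inr (j, block_mset (idx_at k) (pblock P star)))
  else blocks_sum (x_partials s P (Y j)) idx P u.

Lemma smooth_x_partials s P f : smooth f -> smooth (x_partials s P f).
Proof. exact: smooth_partials. Qed.

Lemma prolong_term_star A s P C u : partial_partition A P -> C \in P -> star \in C ->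
  prolong_term s P u =
    - \sum_(k < n) blocks_sum (x_partials s P (X k)) (idx_at k) (P :\ C) u
                   * u (inr (j, block_mset (idx_at k) C)).
Proof.
move=> pP CP sC; rewrite /prolong_term (partial_partition_pblock pP CP sC).
by rewrite ifT //; apply/bigcupP; exists C.
Qed.

Lemma x_partials_unused s P x f : x \notin cover P ->
  x_partials (x :: s) P f = partial (lshift m (idx x)) (x_partials s P f).
Proof. by move=> xP; rewrite /x_partials /= xP. Qed.

Lemma x_partials_used s P Q x f : x \notin s -> cover Q = x |: cover P ->
  x_partials (x :: s) Q f = x_partials s P f.
Proof.
move=> xs cQ; rewrite /x_partials /= cQ setU11 /=; congr (partials (map _ _) f).
apply: eq_in_filter => t ts; rewrite !inE.
by case: eqP ts xs => // -> ->.
Qed.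

Lemma cover_setU1 P B : cover (B |: P) = B :|: cover P.
Proof.
apply/setP => y; rewrite inE; apply/bigcupP/orP => [[C]|[yB|/bigcupP[C CP yC]]].
- by rewrite in_setU1 => /orP[/eqP -> ->|CP yC]; [left|right; apply/bigcupP; exists C].
- by exists B; rewrite ?setU11.
- by exists C; rewrite // in_setU1 CP orbT.
Qed.

Lemma cover_extend_block P B x : B \in P -> cover (extend_block x B P) = x |: cover P.
Proof.
by move=> BP; rewrite cover_setU1 -setUA -cover_setU1 setD1K.
Qed.

(** If [star] is in no block, this is the rule for [blocks_sum] applied to Y^j. If it lies in C,
    each summand is a product: differentiating the factor y^j of C makes x join C, and
    differentiating the rest leaves x out, isolates it or adds it to a block other than C. *)
Lemma has_total_diff_prolong_term lambda A s P x u :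
  x != star -> x \notin s -> x \notin A -> partial_partition A P -> (0 < lambda)%N ->
  (forall B, B \in P -> #|B| < lambda)%N ->
  has_total_diff lambda (idx x) (prolong_term s P) u
    (prolong_term (x :: s) P u + prolong_term (x :: s) ([set x] |: P) u
     + \sum_(B in P) prolong_term (x :: s) (extend_block x B P) u).
Proof.
move=> xstar xs xA pP l0 sP; have xP := partial_partition_fresh xA pP.
have xcP : x \notin cover P.
  by apply/negP => /bigcupP[B BP]; rewrite (negPf (xP _ BP)).
have [pQ nQ] := partial_partition_singleton xA pP.
have [/bigcupP[C CP starC]|nstar] := boolP (star \in cover P); last first.
  have E : prolong_term s P = blocks_sum (x_partials s P (Y j)) idx P.
    by apply/funext => v; rewrite /prolong_term (negPf nstar).
  rewrite E; apply: has_total_diff_eq.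
    by apply: (has_total_diff_blocks_sum idx u _ l0 pP xA sP); exact: smooth_x_partials.
  congr (_ + _ + _).
  - by rewrite /prolong_term (negPf nstar) x_partials_unused.
  - rewrite /prolong_term cover_setU1 !inE eq_sym (negPf xstar) (negPf nstar).
    by rewrite (@x_partials_used s P) // cover_setU1.
  - apply: eq_bigr => B BP; rewrite /prolong_term cover_extend_block //.
    rewrite !inE eq_sym (negPf xstar) (negPf nstar).
    by rewrite (@x_partials_used s P) // cover_extend_block.
have E : prolong_term s P = fun v => - \sum_(k < n)
    blocks_sum (x_partials s P (X k)) (idx_at k) (P :\ C) v
      * v (inr (j, block_mset (idx_at k) C)).
  by apply/funext => v; rewrite (prolong_term_star _ _ pP CP starC).
have idx_x k : idx_at k x = idx x by rewrite /idx_at (negPf xstar).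
have pP' : partial_partition A (P :\ C).
  case/partial_partitionP: pP => tP P0 PA; apply/partial_partitionP; split.
  - by move=> B D y; rewrite !inE => /andP[_ BP] /andP[_ DP]; exact: tP.
  - by move=> B; rewrite inE => /andP[_ /P0].
  - by move=> B; rewrite inE => /andP[_ /PA].
rewrite E; apply: has_total_diff_eq.
  apply/has_total_diffN/has_total_diff_sum => k _; apply: has_total_diffM.
    rewrite -(idx_x k); apply: (has_total_diff_blocks_sum (idx_at k) u _ l0 pP' xA).
      exact: smooth_x_partials.
    by move=> B; rewrite inE => /andP[_]; exact: sP.
  by apply: has_total_diff_coord; rewrite size_block_mset; exact: sP.
(* The family where x joins C is set apart, as it alone comes from the derivative of the factor
   y^j. *)
rewrite [in RHS](bigD1 C) //=.
rewrite (prolong_term_star _ _ pP CP starC).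
have CQ : C \in [set x] |: P by rewrite in_setU1 CP orbT.
rewrite (prolong_term_star _ _ pQ CQ starC).
have [pE _ _] := partial_partition_extend xA pP CP.
have CE : x |: C \in extend_block x C P by rewrite in_extend_block eqxx.
have starE : star \in x |: C by rewrite in_setU1 starC orbT.
rewrite (prolong_term_star _ _ pE CE starE).
have E4 B : B \in P -> B != C -> prolong_term (x :: s) (extend_block x B P) u =
  - \sum_(k < n) blocks_sum (x_partials s P (X k)) (idx_at k) (extend_block x B (P :\ C)) u
      * u (inr (j, block_mset (idx_at k) C)).
  move=> BP BC; have [pB _ _] := partial_partition_extend xA pP BP.
  have CB : C \in extend_block x B P by rewrite in_extend_block [C == B]eq_sym BC CP orbT.
  rewrite (prolong_term_star _ _ pB CB starC); congr (- _); apply: eq_bigr => k _.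
  rewrite (@x_partials_used s P) ?cover_extend_block //; congr (blocks_sum _ _ _ _ * _).
  apply/setP => D; rewrite /extend_block !inE.
  have [->|/= DC] := eqVneq D C; rewrite ?andbF ?orbF ?andbT //=.
  by apply/esym/eqP => CxB; have := xP _ CP; rewrite CxB setU11.
rewrite [X in _ + (_ + X)](_ : _ = \sum_(B in P :\ C)  - \sum_(k < n)
      blocks_sum (x_partials s P (X k)) (idx_at k) (extend_block x B (P :\ C)) u
      * u (inr (j, block_mset (idx_at k) C))); last first.
  apply: eq_big => B; first by rewrite !inE andbC.
  by move=> /andP[BP BC]; rewrite E4.
rewrite sumrN exchange_big /= -!opprD -!big_split /=; congr (- _); apply: eq_bigr => k _.
rewrite idx_x x_partials_unused // !mulrDl mulr_suml -!addrA; congr (_ + (_ + _)).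
  rewrite (@x_partials_used s P) // ?cover_setU1 //; congr (blocks_sum _ _ _ _ * _).
  apply/setP => D; rewrite !inE; have [->|//] := eqVneq D C; rewrite ?andbF ?orbF //.
  by apply/eqP => Cx; move: (xP _ CP); rewrite Cx set11.
rewrite addrC (@x_partials_used s P) // ?cover_extend_block //.
congr (blocks_sum _ _ _ _ * u _ + _).
  rewrite /extend_block setU1K // !inE negb_and; apply/orP; right.
  by apply/negP => /xP; rewrite setU11.
by rewrite block_mset_setU1 ?xP // idx_x.
Qed.

(** With A the old set of positions, the excluded family {A} would produce {A}, {{x}, A} and {x |:
    A}. The last one is excluded again, and the other two are what the correction term of the
    recursion has to provide. *)
Lemma prolong_revE (s : seq T) u : uniq s -> star \notin s ->
  prolong_rev X Y j (map idx s) u =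
  \sum_(P | partial_partition (star |: [set t in s]) P && (P != [set star |: [set t in s]]))
     prolong_term s P u.
Proof.
elim: s u => [|x s IH] u /=.
  move=> _ _; rewrite (big_pred1 set0) => [|P] /=.
    rewrite /prolong_term /cover big_set0 inE /blocks_sum enum_set0 /=.
    by rewrite /x_partials.
  rewrite [[set t in [::]]](_ : _ = set0) ?setU0; last by apply/setP => t; rewrite !inE.
  apply/idP/eqP => [/andP[/partial_partitionP[tP P0 PA] nP]|->].
    (* Every block equals {star}, so a nonempty family is the excluded one. *)
    apply: contraNeq nP => /set0Pn[B BP]; apply/eqP/setP => C; rewrite inE.
    have in_star D : D \in P -> D = [set star].
      move=> DP; have [y yD] := P0 D DP; have := subsetP (PA D DP).
      move=> sub; apply/setP => z; apply/idP/idP => [/sub //|].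
      by rewrite inE => /eqP ->; have := sub y yD; rewrite inE => /eqP <-.
    by apply/idP/eqP => [/in_star //|->]; rewrite -(in_star B).
  apply/andP; split; first by apply/partial_partitionP; split=> B; rewrite inE.
  by apply/eqP => /setP /(_ [set star]); rewrite !inE eqxx.
move=> /andP[xs us]; rewrite inE negb_or => /andP[starx stars].
have xstar : x != star by rewrite eq_sym.
set A := star |: [set t in s].
have xA : x \notin A by rewrite !inE negb_or eq_sym starx.
have -> : star |: [set t in x :: s] = x |: A.
  by apply/setP => t; rewrite !inE orbCA.
have cardA : #|A| = (size s).+1.
  rewrite cardsU1 inE stars; congr _.+1; rewrite -(card_uniqP us).
  by apply: eq_card => t; rewrite inE.
have pA : partial_partition A [set A].
  apply/partial_partitionP; split=> [B C t|B|B]; rewrite !inE.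
  - by move=> /eqP -> /eqP ->.
  - by move=> /eqP ->; exists star; rewrite setU11.
  - by move=> /eqP ->.
have EA : extend_block x A [set A] = [set x |: A].
  by rewrite /extend_block setDv setU0.
have pxA : partial_partition (x |: A) [set x |: A].
  by rewrite -EA; have [] := partial_partition_extend xA pA (set11 A).
(* The excluded term is added to both sides, so that [sum_partial_partition] applies to the full
   sum. *)
apply/eqP; rewrite -(inj_eq (addrI (prolong_term (x :: s) [set x |: A] u))).
rewrite -[X in _ == X](bigD1 [set x |: A]) //=.
rewrite (sum_partial_partition xA) (bigD1 [set A]) //= big_set1 EA.
have -> : prolong_rev X Y j [seq idx i | i <- s] =
    fun v => \sum_(P | partial_partition A P && (P != [set A])) prolong_term s P v.
  by apply/funext => v; exact: IH.
rewrite size_map.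
have step P : partial_partition A P && (P != [set A]) ->
    has_total_diff (size s).+1 (idx x) (prolong_term s P) u
      (prolong_term (x :: s) P u + prolong_term (x :: s) ([set x] |: P) u
       + \sum_(B in P) prolong_term (x :: s) (extend_block x B P) u).
  move=> /andP[pP nP]; apply: (has_total_diff_prolong_term _ _ xs xA pP) => //.
  (* A block equal to A would be the only one, by disjointness. In the other families each block is
     a proper subset of A, and its order stays below the truncation order. *)
  move=> B BP; rewrite -cardA; apply: proper_card; rewrite properEneq.
  case/partial_partitionP: pP => tP P0 PA; rewrite PA // andbT.
  apply: contra nP => /eqP BA; apply/eqP/setP => C; rewrite inE.
  apply/idP/eqP => [CP|->]; last by rewrite -BA.
  have [y yC] := P0 C CP; rewrite -BA; apply: (tP _ _ y) => //.
  by rewrite BA; exact: (subsetP (PA C CP)).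
rewrite (total_diffE (has_total_diff_sum _ step)).
(* In {A} all positions are used, so X^k is not differentiated. The part of D_i^1 X^k along x^i
   gives the term of {A}, the part along the y^l that of {{x}, A}. *)
have -> : \sum_(k < n) total_diff 1 (idx x) (fun v => X k (base v)) u
      * u (ycoord j (rcons (rev [seq idx i | i <- s]) k)) =
    - (prolong_term (x :: s) [set A] u + prolong_term (x :: s) ([set x] |: [set A]) u).
  have [pQ _] := partial_partition_singleton xA pA.
  have starA : star \in A by rewrite setU11.
  rewrite (prolong_term_star _ _ pA (set11 A) starA).
  rewrite (prolong_term_star _ _ pQ (setU1r _ (set11 A)) starA).
  rewrite -opprD opprK -big_split; apply: eq_bigr => k _.
  have -> : ycoord j (rcons (rev [seq idx i | i <- s]) k) = inr (j, block_mset (idx_at k) A).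
    congr (inr (j, _)); apply/eq_seq_msetP.
    have -> : k = idx_at k star by rewrite /idx_at eqxx.
    have -> : [seq idx i | i <- s] = [seq idx_at k i | i <- s].
      apply/eq_in_map => t ts; rewrite /idx_at.
      by case: eqP stars => // <-; rewrite ts.
    rewrite -map_rev -map_rcons /idx_at eqxx; apply: perm_map; apply: uniq_perm.
    - by rewrite rcons_uniq mem_rev stars rev_uniq.
    - exact: enum_uniq.
    - by move=> t; rewrite mem_rcons mem_enum !inE mem_rev.
  have cover_A : cover [set A] = A.
    by apply/setP => y; apply/bigcupP/idP => [[C]|yA];
      [rewrite inE => /eqP -> | exists A; rewrite ?set11].
  have xs0 t : t \in s -> t \in A by move=> ts; rewrite !inE ts orbT.
  have unused f : x_partials s [set A] f = f.
    rewrite /x_partials cover_A.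
    by rewrite (eq_in_filter (a2 := pred0)) ?filter_pred0 // => t /xs0 ->.
  rewrite (@x_partials_used s [set A] ([set x] |: [set A])) ?cover_setU1 //.
  rewrite (@x_partials_unused s [set A]) ?cover_A // !unused setDv.
  have -> : ([set x] |: [set A]) :\ A = [set [set x]].
    by rewrite setUC setU1K // inE; apply: contra xA => /eqP ->; rewrite set11.
  rewrite /blocks_sum enum_set0 enum_set1 /= block_mset_set1 -mulrDl.
  have -> : idx_at k x = idx x by rewrite /idx_at (negPf xstar).
  congr (_ * _); exact/total_diffE/has_total_diff_base.
set t0 := prolong_term _ [set x |: A] u.
by apply/eqP; rewrite opprK addrCA (addrC t0) [LHS]addrC.
Qed.

End ProlongationExpansion.

(** * Partitions obtained from permutations *)

Section BlockPartition.
Import mathcomp.boot.fintype mathcomp.boot.finset.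
Context (d r s : nat) (lam : {ffun 'I_d -> 'I_r}) (mu : {ffun 'I_d -> 'I_s}).
Notation M := (weight lam mu).
Implicit Types (b : block mu) (sigma h : 'S_M).

Definition fiber b : {set 'I_M} := [set a | block_of a == b].

Lemma rank_ofK : cancel (@rank_of _ _ _ lam mu) (@triple_of _ _ _ lam mu).
Proof. by move=> t; rewrite /triple_of /rank_of cast_ordK enum_rankK. Qed.

Lemma triple_ofK : cancel (@triple_of _ _ _ lam mu) (@rank_of _ _ _ lam mu).
Proof. by move=> a; rewrite /triple_of /rank_of enum_valK cast_ordKV. Qed.

Lemma perm_lower_indices (S : eqType) (k : 'I_M -> S) b :
  perm_eq (lower_indices k b) [seq k a | a <- enum (fiber b)].
Proof.
rewrite /lower_indices (map_comp k (fun gamma => rank_of (@mktriple _ _ _ lam mu b gamma))).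
apply/perm_map/uniq_perm; rewrite ?enum_uniq //.
  rewrite map_inj_uniq ?enum_uniq // => g g' /(can_inj rank_ofK) /eqP.
  by rewrite eq_Tagged => /eqP.
move=> a; rewrite mem_enum inE; apply/mapP/eqP => [[g _ ->]|].
  by rewrite /block_of rank_ofK.
rewrite /block_of -{2}[a]triple_ofK; case: (triple_of a) => b' g /= E.
by move: g; rewrite E => g; exists g; rewrite ?mem_enum.
Qed.

Lemma card_fiber b : #|fiber b| = lam (tag b).
Proof.
have := perm_size (perm_lower_indices id b).
by rewrite /lower_indices 2!size_map -!cardE card_ord => ->.
Qed.

Lemma weight_sum_blocks : (\sum_(b : block mu) lam (tag b))%N = M.
Proof.
rewrite -[RHS]card_ord -sum1_card (partition_big (@block_of _ _ _ lam mu) predT) //=.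
apply: eq_bigr => b _; rewrite -card_fiber -sum1_card.
by apply: eq_bigl => a; rewrite inE.
Qed.

Hypothesis lam_gt0 : forall e, (0 < lam e)%N.

Lemma fiber_neq0 b : exists a, a \in fiber b.
Proof. by apply/set0Pn; rewrite -card_gt0 card_fiber. Qed.

Lemma monomial_fibers (k : 'I_M -> 'I_M) (kI : injective k) :
  monomial k = seq_mset [seq seq_mset (enum (k @: fiber b)) | b <- enum {: block mu}].
Proof.
congr seq_mset; apply: eq_map => b; apply/eq_seq_msetP.
apply: perm_trans (perm_lower_indices _ _) _; apply: uniq_perm.
- by rewrite map_inj_uniq ?enum_uniq.
- exact: enum_uniq.
move=> a; rewrite mem_enum; apply/mapP/imsetP => -[a' Ha ->]; exists a' => //.
  by rewrite mem_enum in Ha.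
by rewrite mem_enum.
Qed.

(** The fibers are nonempty and disjoint, so no symbol of the formal monomial is repeated, and
    equality of multisets of multisets reduces to equality of sets of sets. *)
Lemma stab_monomialE h :
  (h \in stab_monomial lam mu) =
  ([set h @: fiber b | b : block mu] == [set fiber b | b : block mu]).
Proof.
have msetI (A B : {set 'I_M}) : seq_mset (enum A) = seq_mset (enum B) -> A = B.
  move/eq_seq_msetP/perm_mem => E; apply/setP => a.
  by have := E a; rewrite !mem_enum.
have fiberI b b' : fiber b = fiber b' -> b = b'.
  have [a ab] := fiber_neq0 b => E; move: (ab); rewrite E; move: ab.
  by rewrite !inE => /eqP <- /eqP <-.
rewrite inE (monomial_fibers (@perm_inj _ h)) (monomial_fibers (@inj_id _)).
have idE b : id @: fiber b = fiber b by rewrite imset_id.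
apply/eqP/eqP => [/eq_seq_msetP E|E]; last first.
  apply/eq_seq_msetP/uniq_perm.
  - rewrite map_inj_uniq ?enum_uniq // => b b' /msetI /(imset_inj (@perm_inj _ h)).
    exact: fiberI.
  - rewrite map_inj_uniq ?enum_uniq // => b b' /msetI; rewrite !idE.
    exact: fiberI.
  move=> A; apply/mapP/mapP => -[b _ ->].
    have : h @: fiber b \in [set fiber b | b : block mu] by rewrite -E imset_f.
    by case/imsetP => b' _ ->; exists b'; rewrite ?mem_enum // idE.
  have : fiber b \in [set h @: fiber b | b : block mu] by rewrite E imset_f.
  by case/imsetP => b' _; rewrite idE => ->; exists b'; rewrite ?mem_enum.
have {}E := perm_mem E.
apply/setP => A; apply/imsetP/imsetP => -[b _ ->].
  have : seq_mset (enum (h @: fiber b)) \in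
      [seq seq_mset (enum (id @: fiber b)) | b <- enum {: block mu}].
    by rewrite -E; apply/mapP; exists b; rewrite ?mem_enum.
  by case/mapP => b' _ /msetI ->; exists b'; rewrite ?idE.
have : seq_mset (enum (id @: fiber b)) \in
    [seq seq_mset (enum (h @: fiber b)) | b <- enum {: block mu}].
  by rewrite E; apply/mapP; exists b; rewrite ?mem_enum.
by case/mapP => b' _ /msetI; rewrite idE => ->; exists b'.
Qed.

Context (T : finType).
Implicit Types (rho : 'I_M -> T) (P : {set {set T}}).

(** Place [a] carries the index k_{sigma(a)}; the block b therefore collects the places that sigma
    sends into its fiber, and [rho] tells which element sits at each place. *)
Definition block_image rho sigma b : {set T} :=
  [set rho a | a in 'I_M & block_of (sigma a) == b].

Definition image_partition rho sigma : {set {set T}} :=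
  [set block_image rho sigma b | b : block mu].

Definition has_block_type P :=
  perm_eq [seq #|B| | B : {set T} <- enum P]
          [seq (lam (tag b) : nat) | b <- enum {: block mu}].

Lemma block_imageE rho sigma b : block_image rho sigma b = rho @: (sigma^-1%g @: fiber b).
Proof.
apply/setP => t; apply/imsetP/imsetP => -[a].
  rewrite inE => ab ->; exists a => //; apply/imsetP; exists (sigma a); rewrite ?inE //.
  by rewrite permK.
case/imsetP => a' ab -> ->; exists (sigma^-1 a')%g => //.
by rewrite inE permKV; rewrite inE in ab.
Qed.

Lemma card_block_image rho sigma b : injective rho -> #|block_image rho sigma b| = lam (tag b).
Proof.
by move=> rI; rewrite block_imageE card_imset // card_imset ?card_fiber //; exact: perm_inj.
Qed.

Lemma block_image_inj rho sigma : injective rho -> injective (block_image rho sigma).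
Proof.
move=> rI b b' E; have [a ab] : exists a, a \in sigma^-1%g @: fiber b.
  by have [a ab] := fiber_neq0 b; exists (sigma^-1 a)%g; rewrite imset_f.
have : rho a \in block_image rho sigma b' by rewrite -E block_imageE imset_f.
rewrite block_imageE (mem_imset _ _ rI) => ab'.
case/imsetP: ab => c cb Ea; case/imsetP: ab' => c' cb' Ea'.
have E' : c = c' by apply: (@perm_inj _ sigma^-1%g); rewrite -Ea.
by move: cb cb'; rewrite -E' !inE => /eqP <- /eqP <-.
Qed.

Lemma mem_block_image rho sigma a b : injective rho ->
  (rho a \in block_image rho sigma b) = (block_of (sigma a) == b).
Proof. by move=> rI; rewrite (mem_imset _ _ rI) inE. Qed.

Lemma perm_enum_image_partition rho sigma : injective rho ->
  perm_eq (enum (image_partition rho sigma))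
          [seq block_image rho sigma b | b <- enum {: block mu}].
Proof.
move=> rI; apply: uniq_perm => [||B]; first exact: enum_uniq.
  by rewrite map_inj_uniq ?enum_uniq //; exact: block_image_inj.
by rewrite mem_enum; apply/imsetP/mapP => -[b _ ->]; exists b; rewrite ?mem_enum.
Qed.

Lemma image_partitionP rho sigma : injective rho ->
  [/\ partial_partition [set: T] (image_partition rho sigma),
      cover (image_partition rho sigma) = rho @: [set: 'I_M] &
      has_block_type (image_partition rho sigma)].
Proof.
move=> rI; have sub_rho b t : t \in block_image rho sigma b -> exists a, t = rho a.
  by case/imsetP => a _ ->; exists a.
split.
- apply/partial_partitionP; split=> [B C t|B|B _]; last exact: subsetT.
    move=> /imsetP[b _ ->] /imsetP[c _ ->] /[dup] /sub_rho[a ->].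
    by rewrite !mem_block_image // => /eqP -> /eqP ->.
  move=> /imsetP[b _ ->]; have [a ab] := fiber_neq0 b; exists (rho ((sigma^-1)%g a)).
  by rewrite mem_block_image // permKV; rewrite inE in ab.
- apply/setP => t; apply/bigcupP/imsetP => [[B /imsetP[b _ ->] /sub_rho[a ->]]|[a _ ->]].
    by exists a.
  exists (block_image rho sigma (block_of (sigma a))); first by rewrite imset_f.
  by rewrite mem_block_image.
- rewrite /has_block_type.
  rewrite (permPl (perm_map _ (perm_enum_image_partition sigma rI))) -map_comp.
  rewrite (eq_map (g := fun b : block mu => (lam (tag b) : nat))) // => b /=.
  by rewrite card_block_image.
Qed.

Lemma image_partition_stab rho sigma h : injective rho -> h \in stab_monomial lam mu ->
  image_partition rho (sigma * h)%g = image_partition rho sigma.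
Proof.
move=> rI; rewrite stab_monomialE => /eqP E.
have biE b b' : h @: fiber b' = fiber b ->
    block_image rho (sigma * h)%g b = block_image rho sigma b'.
  move=> hb; have Ea a : (block_of ((sigma * h)%g a) == b) = (block_of (sigma a) == b').
    have := mem_imset (mem (fiber b')) (sigma a) (@perm_inj _ h).
    by rewrite hb !inE permM.
  by apply/setP => t; apply/imsetP/imsetP => -[a]; rewrite inE => ab ->;
    exists a; rewrite // inE ?Ea // -Ea.
apply/setP => B; apply/imsetP/imsetP => -[b _ ->].
  have : fiber b \in [set h @: fiber b | b : block mu] by rewrite E imset_f.
  by case/imsetP => b' _ hb; exists b' => //; apply: biE; rewrite -hb.
have : h @: fiber b \in [set fiber b | b : block mu] by rewrite -E imset_f.
by case/imsetP => b' _ hb; exists b' => //; rewrite (biE _ _ hb).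
Qed.

(** With [image_partition_stab]: two permutations give the same partition exactly when they lie in
    the same coset. The quotient [sigma^-1 * sigma'] maps fibers to fibers because it maps the
    places of a block to the places of an equal block. *)
Lemma image_partition_eq rho sigma sigma' : injective rho ->
  image_partition rho sigma = image_partition rho sigma' ->
  exists2 h, h \in stab_monomial lam mu & sigma' = (sigma * h)%g.
Proof.
move=> rI E; exists (sigma^-1 * sigma')%g; last by rewrite mulKVg.
have hE b b' : block_image rho sigma b = block_image rho sigma' b' ->
    (sigma^-1 * sigma')%g @: fiber b = fiber b'.
  rewrite !block_imageE => /(imset_inj rI) Eb; apply/setP => a.
  have := mem_imset (mem (fiber b')) a (@perm_inj _ sigma'^-1%g).
  rewrite -Eb => {Eb}<-; apply/imsetP/imsetP => -[c cb].
    by rewrite permM => ->; exists c; rewrite // permK.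
  by move=> ac; exists c; rewrite // permM -ac permKV.
rewrite stab_monomialE; apply/eqP/setP => A; apply/imsetP/imsetP => -[b _ ->].
  have : block_image rho sigma b \in image_partition rho sigma' by rewrite -E imset_f.
  by case/imsetP => b' _ /hE ->; exists b'.
have : block_image rho sigma' b \in image_partition rho sigma by rewrite E imset_f.
by case/imsetP => b' _ /esym /hE <-; exists b'.
Qed.

(** The blocks of P are matched with the symbols b of the same size, and sigma rearranges the places
    so that each falls into the fiber of the symbol of its block. *)
Lemma image_partition_surj rho P : injective rho ->
  partial_partition [set: T] P -> cover P = rho @: [set: 'I_M] -> has_block_type P ->
  exists sigma, image_partition rho sigma = P.
Proof.
move=> rI pP cP tP.
(* [L] lists the blocks of P so that their sizes appear in the order of the symbols; [beta] is the
   resulting matching. *)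
have [L PL EL] : exists2 L, perm_eq L (enum P) &
    [seq #|B| | B : {set T} <- L] = [seq (lam (tag b) : nat) | b <- enum {: block mu}].
  move: tP; rewrite /has_block_type perm_sym => /(perm_iotaP 0%N)[Is PI ->].
  rewrite size_map in PI.
  exists [seq nth set0 (enum P) k | k <- Is].
    by apply/(perm_iotaP set0); exists Is.
  rewrite -map_comp; apply/eq_in_map => k.
  by rewrite (perm_mem PI) mem_iota /= => kP; rewrite (nth_map set0).
have sL : size L = size (enum {: block mu}).
  by rewrite -(size_map (fun B : {set T} => #|B|)) EL size_map.
have uL : uniq L by rewrite (perm_uniq PL) enum_uniq.
pose beta (b : block mu) := nth set0 L (index b (enum {: block mu})).
have ib (b : block mu) : (index b (enum {: block mu}) < size L)%N.
  by rewrite sL index_mem mem_enum.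
have beta_card b : #|beta b| = lam (tag b).
  have := congr1 (nth 0%N ^~ (index b (enum {: block mu}))) EL.
  rewrite (nth_map set0) ?ib // => -> .
  by rewrite (nth_map b) -?sL ?ib // nth_index ?mem_enum.
have beta_inj : injective beta.
  move=> b b' /eqP; rewrite nth_uniq ?ib // => /eqP.
  by move/(congr1 (nth b (enum {: block mu}))); rewrite !nth_index ?mem_enum.
have beta_in b : beta b \in P by rewrite -mem_enum -(perm_mem PL) mem_nth.
have beta_surj B : B \in P -> exists b, B = beta b.
  rewrite -mem_enum -(perm_mem PL) => BL.
  have iB : (index B L < size (enum {: block mu}))%N by rewrite -sL index_mem.
  have [b0 _] : exists b0 : block mu, b0 \in enum {: block mu}.
    by case: (enum {: block mu}) iB => // b0 l _; exists b0; rewrite mem_head.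
  exists (nth b0 (enum {: block mu}) (index B L)).
  by rewrite /beta index_uniq ?enum_uniq // nth_index.
have /fin_all_exists[c cE] : forall a : 'I_M, exists b, rho a \in beta b.
  move=> a; have : rho a \in cover P by rewrite cP imset_f.
  by case/bigcupP => B /beta_surj[b ->]; exists b.
have c_eq a b : (c a == b) = (rho a \in beta b).
  apply/eqP/idP => [<- //|ab]; apply: beta_inj.
  by case/partial_partitionP: pP => tr _ _; apply: (tr _ _ (rho a)).
have img_c b : rho @: [set a | c a == b] = beta b.
  apply/setP => t; apply/imsetP/idP => [[a]|tb].
    by rewrite inE c_eq => ab ->.
  have : t \in rho @: [set: 'I_M] by rewrite -cP; apply/bigcupP; exists (beta b).
  by case/imsetP => a _ ta; exists a => //; rewrite inE c_eq -ta.
have countE (g : 'I_M -> block mu) b :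
    count_mem b [seq g a | a <- enum 'I_M] = #|[set a | g a == b]|.
  by rewrite cardE size_filter count_map enumT; apply: eq_count => a; rewrite /= inE.
(* Each b occurs [lam (tag b)] times in both words, so one is a rearrangement of the other. *)
have /tuple_permP[sigma Es] :
    perm_eq [tuple c a | a < M] [tuple block_of (lam := lam) (mu := mu) a | a < M].
  rewrite -[[tuple c a | a < M] : seq _]/[seq c a | a <- ord_tuple M].
  apply/allP => b _ /=; apply/eqP.
  rewrite !countE; have := card_fiber b; rewrite /fiber => ->.
  by rewrite -beta_card -img_c card_imset.
exists sigma.
have sigmaE a : block_of (sigma a) = c a.
  have := congr1 (fun t => nth (c a) t a) Es.
  by rewrite -!tnth_nth !tnth_mktuple.
have biE b : block_image rho sigma b = beta b.
  rewrite -img_c; apply/setP => t; apply/imsetP/imsetP => -[a];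
    by rewrite inE ?sigmaE => ab ->; exists a; rewrite // inE ?sigmaE.
apply/setP => B; apply/imsetP/idP => [[b _ ->]|/beta_surj[b ->]]; first by rewrite biE.
by exists b.
Qed.

End BlockPartition.

(** * Sums over coset representatives and shuffles *)

Section SumOverCosets.
Import mathcomp.boot.fintype mathcomp.boot.finset.
Context (d r s : nat) (lam : {ffun 'I_d -> 'I_r}) (mu : {ffun 'I_d -> 'I_s}).
Notation M := (weight lam mu).
Hypothesis lam_gt0 : forall e, (0 < lam e)%N.
Context (T : finType) (V : nmodType) (Phi : {set {set T}} -> V).

Lemma card_cover_block_type A (P : {set {set T}}) :
  partial_partition A P -> has_block_type lam mu P -> #|cover P| = M.
Proof.
case/and3P => /eqP <- _ _ tP; rewrite -(weight_sum_blocks lam mu).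
have := perm_big _ tP (x := 0%N) (op := addn) (F := id) (P := xpredT).
by rewrite !big_map !big_enum.
Qed.

(** The map from sigma to its partition is constant on cosets, separates them and reaches every
    partition of the given cover and type. A transversal meets each coset once, so each partition
    occurs once, whatever the choice of representatives. *)
Lemma coset_representatives_sum (S : {set 'S_M}) (rho : 'I_M -> T) :
  coset_representatives S -> injective rho ->
  \sum_(sigma in S) Phi (image_partition rho sigma) =
  \sum_(P | [&& partial_partition [set: T] P, cover P == rho @: [set: 'I_M] &
               has_block_type lam mu P]) Phi P.
Proof.
move=> /and3P[_ _ /forall_inP S1] rI.
have S_unique sigma0 : #|S :&: (sigma0 *: stab_monomial lam mu)%g| = 1%N.
  by apply/eqP/S1; apply/imsetP; exists sigma0; rewrite ?inE ?lcosetE.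
have lcosetP' sigma0 sigma1 :
    reflect (exists2 h, h \in stab_monomial lam mu & sigma1 = (sigma0 * h)%g)
    (sigma1 \in (sigma0 *: stab_monomial lam mu)%g) by exact: lcosetP.
have one_in : 1%g \in stab_monomial lam mu.
  rewrite stab_monomialE //; apply/eqP/eq_imset => b.
  apply/setP => a; apply/imsetP/idP => [[a' a'b ->]|ab]; first by rewrite perm1.
  by exists a; rewrite ?perm1.
rewrite -big_imset /=; last first.
  move=> sigma sigma' sS sS' /(image_partition_eq lam_gt0 rI)[h hH E].
  have /eqP/cards1P[x Sx] := S_unique sigma.
  have : sigma \in S :&: (sigma *: stab_monomial lam mu)%g.
    by rewrite inE sS; apply/lcosetP'; exists 1%g; rewrite ?mulg1.
  have : sigma' \in S :&: (sigma *: stab_monomial lam mu)%g.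
    by rewrite inE sS'; apply/lcosetP'; exists h.
  by rewrite Sx !inE => /eqP -> /eqP ->.
apply: eq_bigl => P; apply/imsetP/and3P => [[sigma _ ->]|[pP /eqP cP tP]].
  by have [-> -> ->] := image_partitionP lam_gt0 sigma rI; split.
have [sigma0 E0] := image_partition_surj rI pP cP tP.
have /eqP/cards1P[sigma1 Sx] := S_unique sigma0.
have : sigma1 \in S :&: (sigma0 *: stab_monomial lam mu)%g by rewrite Sx set11.
rewrite inE => /andP[S1' /lcosetP'[h hH E]]; exists sigma1 => //.
by rewrite E (image_partition_stab lam_gt0).
Qed.

(** The index tau is recovered from P as the only one whose image is the cover of P. The predicate
    [C] will select the covers with or without [None]. *)
Lemma coset_position_sum (S : {set 'S_M}) (J : finType) (Sh : {set J})
    (rho : J -> 'I_M -> T) (C : pred {set T}) :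
  coset_representatives S ->
  {in Sh, forall tau, injective (rho tau) /\ C (rho tau @: [set: 'I_M])} ->
  {in Sh &, injective (fun tau => rho tau @: [set: 'I_M])} ->
  (forall A, C A -> #|A| = M -> exists2 tau, tau \in Sh & rho tau @: [set: 'I_M] = A) ->
  \sum_(sigma in S) \sum_(tau in Sh) Phi (image_partition (rho tau) sigma) =
  \sum_(P | [&& partial_partition [set: T] P, C (cover P) & has_block_type lam mu P]) Phi P.
Proof.
move=> hS hrho rhoI rho_surj; rewrite exchange_big /=.
transitivity (\sum_(P | [&& partial_partition [set: T] P, C (cover P) &
                            has_block_type lam mu P])
   \sum_(tau in Sh | rho tau @: [set: 'I_M] == cover P) Phi P); last first.
  apply: eq_bigr => P /and3P[pP cP tP].
  have [tau tauSh Etau] := rho_surj _ cP (card_cover_block_type pP tP).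
  rewrite (big_pred1 tau) // => tau'; apply/andP/eqP => [[tS /eqP E]|->].
    by apply: rhoI => //; rewrite E Etau.
  by rewrite Etau eqxx.
rewrite (exchange_big_dep (mem Sh)) /=; last by move=> P tau _ /andP[].
apply: eq_bigr => tau tauSh; have [rI rC] := hrho _ tauSh.
rewrite (coset_representatives_sum hS rI); apply: eq_bigl => P.
rewrite tauSh andTb [_ == cover P]eq_sym.
by have [->|_] := eqVneq (cover P); rewrite ?andbF // ?rC ?andbT //.
Qed.

End SumOverCosets.

(** * Sorting families by the sizes of their blocks *)

Section SumOverTypes.
Import mathcomp.boot.fintype mathcomp.boot.finset.
Context (kappa : nat) (T : finType) (V : nmodType) (Phi : {set {set T}} -> V).
Hypothesis cardT : #|T| = kappa.+1.
Implicit Types (P : {set {set T}}).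

Definition block_sizes P : seq nat := [seq #|B| | B : {set T} <- enum P].

Definition increasing d r (lam : {ffun 'I_d -> 'I_r}) : bool :=
  [forall e : 'I_d, (0 < lam e)%N] &&
  [forall e : 'I_d, forall e' : 'I_d, (e < e')%N ==> (lam e < lam e')%N].

Lemma count_block_sizes d r s (lam : {ffun 'I_d -> 'I_r}) (mu : {ffun 'I_d -> 'I_s}) c :
  count_mem c [seq (lam (tag b) : nat) | b <- enum {: block mu}] =
  (\sum_(e | lam e == c :> nat) mu e)%N.
Proof.
rewrite enum_block map_flatten count_flatten sumnE 3!big_map big_enum /=.
rewrite [RHS]big_mkcond; apply: eq_bigr => e _.
rewrite -map_comp count_map /= (eq_count (a2 := fun=> lam e == c :> nat)) //.
case: eqP => _; rewrite ?count_predT ?count_pred0 //.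
by rewrite -cardE card_ord.
Qed.

Section FixedType.
Context (d r s : nat) (lam : {ffun 'I_d -> 'I_r}) (mu : {ffun 'I_d -> 'I_s}).
Hypotheses (lam_incr : increasing lam) (mu_gt0 : forall e, (0 < mu e)%N).

Lemma increasing_inj e e' : lam e = lam e' :> nat -> e = e'.
Proof.
case/andP: lam_incr => _ /forallP H E; apply/val_inj/eqP; apply: contraT.
rewrite neq_ltn => /orP[] lt.
  by have /forallP /(_ e') := H e; rewrite lt E ltnn.
by have /forallP /(_ e) := H e'; rewrite lt E ltnn.
Qed.

Lemma has_block_type_count P e : has_block_type lam mu P ->
  count_mem (lam e : nat) (block_sizes P) = mu e.
Proof.
move/seq.permP => ->; rewrite count_block_sizes (big_pred1 e) // => e'.
by apply/eqP/eqP => [/increasing_inj|->].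
Qed.

Lemma has_block_type_mem P c : has_block_type lam mu P ->
  (c \in block_sizes P) = [exists e, lam e == c :> nat].
Proof.
move/seq.permP => E; rewrite -has_pred1 has_count E count_block_sizes.
apply/idP/existsP => [|[e ec]]; last by rewrite (bigD1 e) //= ltn_addr.
rewrite lt0n sum_nat_eq0 negb_forall => /existsP[e]; rewrite negb_imply => /andP[ec _].
by exists e.
Qed.

(** This and [has_block_type_count] give uniqueness of the type: lambda lists the distinct block
    sizes in increasing order, mu their multiplicities. *)
Lemma has_block_type_values P : has_block_type lam mu P ->
  [seq (lam e : nat) | e <- enum 'I_d] = sort leq (undup (block_sizes P)).
Proof.
move=> tP; apply: (irr_sorted_eq ltn_trans ltnn).
- apply/(sortedP 0%N) => k; rewrite size_map size_enum_ord => kd.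
  have k'd : (k < d)%N by exact: ltnW.
  have nthE k' : (k' < d)%N -> nth 0%N [seq (lam e : nat) | e <- enum 'I_d] k' =
      lam (nth (Ordinal k'd) (enum 'I_d) k').
    by move=> k'_d; rewrite (nth_map (Ordinal k'd)) ?size_enum_ord.
  rewrite /= !nthE //; case/andP: lam_incr => _.
  move/forallP/(_ (nth (Ordinal k'd) (enum 'I_d) k)).
  move/forallP/(_ (nth (Ordinal k'd) (enum 'I_d) k.+1))/implyP; apply.
  by rewrite !nth_enum_ord.
- by rewrite ltn_sorted_uniq_leq sort_uniq undup_uniq sort_sorted //; exact: leq_total.
move=> c; rewrite mem_sort mem_undup has_block_type_mem //.
apply/mapP/existsP => [[e _ ->]|[e /eqP <-]]; first by exists e.
by exists e; rewrite ?mem_enum.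
Qed.

End FixedType.

(** A family has at most one type, and the ranges of the sums miss only the empty family, because d
    >= 1, and the families with a block of kappa + 1 elements, because lambda takes values at most
    kappa. *)
Lemma sum_types (C : pred {set T}) :
  \sum_(1 <= d < kappa.+2)
    \sum_(lam : {ffun 'I_d -> 'I_kappa.+1} | increasing lam)
    \sum_(mu : {ffun 'I_d -> 'I_kappa.+2} |
            [forall e, (1 <= mu e)%N] && (weight lam mu <= kappa.+1)%N)
    \sum_(P | [&& partial_partition [set: T] P, C (cover P) & has_block_type lam mu P]) Phi P =
  \sum_(P | [&& partial_partition [set: T] P, C (cover P), P != set0 &
               [set: T] \notin P]) Phi P.
Proof.
transitivity (\sum_(P | partial_partition [set: T] P && C (cover P))
  \sum_(1 <= d < kappa.+2)
    \sum_(lam : {ffun 'I_d -> 'I_kappa.+1} | increasing lam)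
    \sum_(mu : {ffun 'I_d -> 'I_kappa.+2} |
            [forall e, (1 <= mu e)%N] && (weight lam mu <= kappa.+1)%N)
    if has_block_type lam mu P then Phi P else 0).
  rewrite exchange_big /=; apply: eq_bigr => d _.
  rewrite exchange_big /=; apply: eq_bigr => lam _.
  rewrite exchange_big /=; apply: eq_bigr => mu _.
  by rewrite -big_mkcondr; apply: eq_bigl => P; rewrite andbA.
rewrite [RHS](eq_bigl (fun P => (partial_partition [set: T] P && C (cover P)) &&
   ((P != set0) && ([set: T] \notin P)))); last by move=> P; rewrite -andbA.
rewrite [RHS]big_mkcondr; apply: eq_bigr => P /andP[pP _].
have sizes_le c : c \in block_sizes P -> (0 < c <= kappa.+1)%N.
  case/mapP => B; rewrite mem_enum => BP ->; rewrite -cardT max_card andbT card_gt0.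
  by case/and3P: pP => _ P0 _; apply: contraNneq P0 => <-; exact: BP.
case: ifPn => [/andP[P0 PT]|bad]; last first.
  rewrite big_nat_cond big1 // => d /andP[/andP[d0 _] _].
  apply: big1 => lam li; apply: big1 => mu /andP[/forallP mu0 _].
  case: ifPn => // tP; case/negP: bad; apply/andP; split.
    apply/eqP => P0; have := has_block_type_count li (Ordinal d0) tP.
    by rewrite P0 /block_sizes enum_set0 /= => /esym/eqP; rewrite -leqn0 leqNgt mu0.
  apply/negP => TP; have : kappa.+1 \in block_sizes P.
    by apply/mapP; exists [set: T]; rewrite ?mem_enum // cardsT cardT.
  rewrite (has_block_type_mem mu0 _ tP) => /existsP[e /eqP le].
  by have := ltn_ord (lam e); rewrite le ltnn.
pose L := sort leq (undup (block_sizes P)).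
have mem_L c : (c \in L) = (c \in block_sizes P) by rewrite mem_sort mem_undup.
have L_lt k : (k < size L)%N -> (nth 0%N L k < kappa.+1)%N.
  move=> kL; have : nth 0%N L k \in block_sizes P by rewrite -mem_L mem_nth.
  move=> /[dup] /sizes_le /andP[_]; rewrite leq_eqVlt => /orP[/eqP -> |//].
  case/mapP => B; rewrite mem_enum => BP EB; case/negP: PT.
  rewrite -(_ : B = [set: T]) //; apply/eqP.
  by rewrite eqEcard subsetT cardsT cardT EB leqnn.
have sizeP : (size (block_sizes P) <= kappa.+1)%N.
  rewrite size_map -cardE -cardT; apply: leq_trans (max_card (mem (cover P))).
  case/and3P: pP => /eqP <- _ _; rewrite -sum1_card; apply: leq_sum => B BP.
  have : #|B| \in block_sizes P by apply/mapP; exists B; rewrite ?mem_enum.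
  by case/sizes_le/andP.
(* The casts by [inord] are faithful: the sizes are at most kappa, and there are at most kappa + 1
   blocks. *)
pose lam0 : {ffun 'I_(size L) -> 'I_kappa.+1} :=
  [ffun e : 'I_(size L) => inord (nth 0%N L e)].
pose mu0 : {ffun 'I_(size L) -> 'I_kappa.+2} :=
  [ffun e : 'I_(size L) => inord (count_mem (nth 0%N L e) (block_sizes P))].
have lam0E e : lam0 e = nth 0%N L e :> nat by rewrite ffunE inordK // L_lt.
have mu0E e : mu0 e = count_mem (nth 0%N L e) (block_sizes P) :> nat.
  by rewrite ffunE inordK // ltnS (leq_trans (count_size _ _)).
have L_sorted : sorted ltn L.
  by rewrite ltn_sorted_uniq_leq sort_uniq undup_uniq sort_sorted //; exact: leq_total.
have lam0_incr : increasing lam0.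
  apply/andP; split; apply/forallP => e.
    rewrite lam0E; have : nth 0%N L e \in block_sizes P by rewrite -mem_L mem_nth.
    by case/sizes_le/andP.
  apply/forallP => e'; apply/implyP => ee'; rewrite !lam0E.
  by apply: (sorted_ltn_nth ltn_trans) => //; rewrite inE.
have mu0_gt0 e : (0 < mu0 e)%N.
  by rewrite mu0E -has_count has_pred1 -mem_L mem_nth.
have typ0 : has_block_type lam0 mu0 P.
  apply/allP => c _; apply/eqP; rewrite count_block_sizes.
  have [cL|cL] := boolP (c \in L).
    have ic : (index c L < size L)%N by rewrite index_mem.
    rewrite (big_pred1 (Ordinal ic)) => [|e]; first by rewrite mu0E /= nth_index.
    rewrite lam0E; apply/eqP/eqP => [ec|->]; last by rewrite /= nth_index.
    by apply: val_inj; rewrite /= -ec index_uniq // sort_uniq undup_uniq.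
  rewrite big1 => [|e /eqP ec]; last by case/negP: cL; rewrite -ec lam0E mem_nth.
  by apply/count_memPn; rewrite -mem_L.
have weight0 : (weight lam0 mu0 <= kappa.+1)%N.
  by rewrite -(card_cover_block_type pP typ0) -cardT max_card.
have L_size : size L \in index_iota 1 kappa.+2.
  rewrite mem_index_iota ltnS; apply/andP; split.
    have /set0Pn[B BP] := P0; have : #|B| \in L.
      by rewrite mem_L; apply/mapP; exists B; rewrite ?mem_enum.
    by case: (L).
  by rewrite size_sort (leq_trans (size_undup _)).
rewrite (bigD1_seq (size L)) ?iota_uniq //= [X in _ + X]big1 ?addr0; last first.
  move=> d dL; apply: big1 => lam li; apply: big1 => mu /andP[/forallP mu0' _].
  case: ifPn => // tP; case/eqP: dL.
  by rewrite -[RHS](congr1 size (has_block_type_values li mu0' tP)) size_map size_enum_ord.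
rewrite (bigD1 lam0) //= [X in _ + X]big1 ?addr0; last first.
  move=> lam /andP[li ne]; apply: big1 => mu /andP[/forallP mu0' _].
  case: ifPn => // tP; case/eqP: ne; apply/ffunP => e; apply: val_inj.
  have := has_block_type_values li mu0' tP.
  rewrite -[sort _ _](has_block_type_values lam0_incr mu0_gt0 typ0).
  by move/eq_in_map/(_ e); apply; rewrite mem_enum.
rewrite (bigD1 mu0) /=; last by rewrite weight0 andbT; apply/forallP.
rewrite typ0 big1 ?addr0 // => mu /andP[/andP[/forallP mu0' _] ne].
case: ifPn => // tP; case/eqP: ne; apply/ffunP => e; apply: val_inj.
rewrite /= -(has_block_type_count lam0_incr e tP).
exact: has_block_type_count.
Qed.

End SumOverTypes.

(** * Shuffles *)

Section Shuffles.
Import mathcomp.boot.fintype mathcomp.boot.finset.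
Context (p : nat).
Implicit Types (tau : 'S_p) (q : nat) (A : {set 'I_p}).

Definition initial_image tau q : {set 'I_p} := tau @: [set a : 'I_p | (a < q)%N].

Lemma mem_initial_image tau q a : (tau a \in initial_image tau q) = (a < q)%N.
Proof. by rewrite (mem_imset _ _ (@perm_inj _ tau)) inE. Qed.

Lemma shuffles_increasing tau q (a b : 'I_p) : tau \in shuffles p q ->
  (a < b)%N -> (b < q)%N || (q <= a)%N -> (tau a < tau b)%N.
Proof.
rewrite /shuffles; case: ifP => _; first by rewrite inE => /eqP ->; rewrite !perm1.
case: ifP => _; last by rewrite inE.
by rewrite inE => /forallP /(_ a) /forallP /(_ b) /implyP H ab bq; rewrite H ?ab.
Qed.

Lemma enum_ord_sorted (D : {pred 'I_p}) : sorted (fun a b : 'I_p => (a < b)%N) (enum D).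
Proof.
rewrite /enum_mem; apply: sorted_filter => [a b c|]; first exact: ltn_trans.
have : sorted ltn (map val (enum 'I_p)) by rewrite val_enum_ord iota_ltn_sorted.
by rewrite sorted_map enumT.
Qed.

(** On each of the two pieces a shuffle lists its image in increasing order, and the image of the
    second piece is the complement of that of the first. *)
Lemma shuffles_inj q : {in shuffles p q &, injective (initial_image^~ q)}.
Proof.
move=> tau tau' tS tS' E.
have eqD (D : {set 'I_p}) :
    (forall a b, a \in D -> b \in D -> (a < b)%N -> (b < q)%N || (q <= a)%N) ->
    tau @: D = tau' @: D -> {in D, tau =1 tau'}.
  move=> DP ED a aD; apply: val_inj.
  suff /eq_in_map : [seq (tau a : nat) | a <- enum D] = [seq (tau' a : nat) | a <- enum D].
    by apply; rewrite mem_enum.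
  have sD t : t \in shuffles p q -> sorted ltn [seq (t a : nat) | a <- enum D].
    move=> tSh; apply: (homo_sorted_in _ _ (enum_ord_sorted D)); last first.
      by apply/allP => c; rewrite mem_enum; apply.
    by move=> b c bD cD bc; apply: (shuffles_increasing tSh) => //; exact: DP.
  apply: (irr_sorted_eq ltn_trans ltnn) => [||c]; [exact: sD|exact: sD|].
  have sub (t t' : 'S_p) : t @: D = t' @: D -> {subset [seq (t a : nat) | a <- enum D] <=
      [seq (t' a : nat) | a <- enum D]}.
    move=> Et x /mapP[b bD ->]; have : t b \in t' @: D by rewrite -Et imset_f // -mem_enum.
    by case/imsetP => b' b'D ->; apply/mapP; exists b'; rewrite ?mem_enum.
  by apply/idP/idP; apply: sub.
have E2 : tau @: [set a : 'I_p | (q <= a)%N] = tau' @: [set a : 'I_p | (q <= a)%N].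
  have compl (t : 'S_p) : t @: [set a : 'I_p | (q <= a)%N] = ~: initial_image t q.
    apply/setP => x; rewrite -(permKV t x) in_setC mem_initial_image.
    by rewrite (mem_imset _ _ (@perm_inj _ t)) inE leqNgt.
  by rewrite !compl E.
apply/permP => a; have [aq|aq] := ltnP a q.
  by apply: (eqD _ _ E); rewrite ?inE // => b c _; rewrite inE => ->.
by apply: (eqD _ _ E2); rewrite ?inE // => b c; rewrite inE => -> _ _; rewrite orbT.
Qed.

(** The shuffle lists A in increasing order, then its complement. *)
Lemma shuffles_surj A : exists2 tau, tau \in shuffles p #|A| & initial_image tau #|A| = A.
Proof.
pose t := enum A ++ enum (~: A).
have sA : size (enum A) = #|A| by rewrite -cardE.
have st : size t = p by rewrite size_cat -!cardE cardsC card_ord.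
have ut : uniq t.
  rewrite cat_uniq !enum_uniq andbT; apply/hasPn => a.
  by rewrite !mem_enum inE.
have tau_inj : injective (fun a : 'I_p => nth a t a).
  move=> a b; rewrite (set_nth_default b) ?st // => /eqP.
  by rewrite nth_uniq ?st // => /eqP /val_inj.
pose tau := perm tau_inj.
have tauE a : tau a = nth a t a by rewrite permE.
have tau_A : initial_image tau #|A| = A.
  apply/setP => x; rewrite -(permKV tau x) mem_initial_image tauE.
  set a := (tau^-1)%g x; rewrite nth_cat sA.
  case: ltnP => aA; first by rewrite -mem_enum mem_nth ?sA.
  have : nth a (enum (~: A)) (a - #|A|) \in enum (~: A).
    by rewrite mem_nth // -cardE -(ltn_add2r #|A|) subnK // addnC cardsC card_ord.
  by rewrite mem_enum inE => /negPf ->.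
(* For these two cardinalities [shuffles] is by definition reduced to the identity. *)
have [A0|A0] := boolP ((#|A| == 0)%N || (#|A| == p)).
  exists 1%g; first by rewrite /shuffles A0 set11.
  case/orP: A0 => [/eqP A0|/eqP Ap].
    rewrite A0; have /eqP := A0; rewrite cards_eq0 => /eqP ->.
    by apply/setP => x; rewrite -(perm1 x) mem_initial_image inE.
  have -> : A = [set: 'I_p] by apply/eqP; rewrite eqEcard subsetT cardsT card_ord Ap /=.
  by apply/setP => x; rewrite -(perm1 x) mem_initial_image cardsT card_ord ltn_ord inE.
exists tau => //; rewrite /shuffles (negPf A0).
have Ap : (#|A| < p)%N.
  move: A0; rewrite negb_or => /andP[_ A0]; rewrite ltn_neqAle A0 /=.
  by rewrite -[X in (_ <= X)%N]card_ord max_card.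
rewrite Ap inE; apply/forallP => a; apply/forallP => b; apply/implyP => /andP[ab].
have nth_sorted (B : {set 'I_p}) k k' : (k < k' < #|B|)%N ->
    (nth a (enum B) k < nth a (enum B) k')%N.
  move=> /andP[kk' k'B].
  apply: (@sorted_ltn_nth _ (fun a b : 'I_p => (a < b)%N) _ a _ (enum_ord_sorted B)) => //.
  - by move=> x y z; exact: ltn_trans.
  - by rewrite inE -cardE (ltn_trans kk').
  - by rewrite inE -cardE.
rewrite !tauE (@set_nth_default _ t a b) ?st // !nth_cat sA => /orP[bA|Aa].
  by rewrite bA (ltn_trans ab bA) nth_sorted // ab.
have Ab : (#|A| <= b)%N := leq_trans Aa (ltnW ab).
rewrite !ltnNge Aa Ab /= -ltnNge; apply: nth_sorted; apply/andP; split.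
  by apply: ltn_sub2r => //; exact: leq_ltn_trans Aa ab.
by rewrite -(ltn_add2r #|A|) subnK // addnC cardsC card_ord.
Qed.

End Shuffles.

(** * Collapsing the sums over k and l *)

Lemma kronecker_eq (K : numFieldType) (n : nat) (s t : seq 'I_n) :
  size s = size t -> kronecker K s t = (s == t)%:R.
Proof.
elim: s t => [|a s IH] [|b t] //= => [_|[st]]; first by rewrite /kronecker big_nil.
rewrite /kronecker big_cons /= -[X in _ * X]/(kronecker K s t) IH // eqseq_cons.
by case: eqP; rewrite ?mul1r ?mul0r.
Qed.

Lemma mem_take_enum_ord (p q : nat) (a : 'I_p) : (a \in take q (enum 'I_p)) = (a < q)%N.
Proof.
rewrite -(mem_map val_inj) map_take val_enum_ord take_iota mem_iota /= add0n.
by rewrite leq_min ltn_ord andbT.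
Qed.

Lemma mem_drop_enum_ord (p q : nat) (a : 'I_p) : (a \in drop q (enum 'I_p)) = (q <= a)%N.
Proof.
rewrite -(mem_map val_inj) map_drop val_enum_ord drop_iota mem_iota /= add0n.
apply: andb_idr => qa; rewrite subnKC ?ltn_ord //.
by rewrite (leq_trans qa) // ltnW.
Qed.

Lemma eq_take_map_enum (p q : nat) (T : eqType) (f g : 'I_p -> T) :
  (take q [seq f a | a <- enum 'I_p] == take q [seq g a | a <- enum 'I_p]) =
  [forall a : 'I_p, (a < q)%N ==> (f a == g a)].
Proof.
rewrite -2!map_take; apply/eqP/forallP => [/eq_in_map E a|E].
  by apply/implyP => aq; apply/eqP/E; rewrite mem_take_enum_ord.
by apply/eq_in_map => a; rewrite mem_take_enum_ord => aq; apply/eqP/(implyP (E a)).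
Qed.

Section CollapseIndices.
Import mathcomp.boot.fintype mathcomp.boot.finset.
Context (R : realType) (K : numFieldType).
Hypothesis hK : K = R :> numFieldType \/ K = R[i] :> numFieldType.
Context (n m : nat).
Context (X : 'I_n -> 'rV[K]_(n + m) -> K) (Y : 'I_m -> 'rV[K]_(n + m) -> K).
Hypotheses (hX : forall k, smooth (X k)) (hY : forall j, smooth (Y j)).
Context (j : 'I_m) (kappa : nat) (i : kappa.-tuple 'I_n) (u : jet K n m).
Context (idx : option 'I_kappa -> 'I_n).
Hypothesis idxE : forall a, idx (Some a) = tnth i a.

(* The extra position [None] stands for the index M of the X-terms. *)
Definition position (q : nat) (tau : 'S_kappa) (a : nat) : option 'I_kappa :=
  if (a < q)%N then omap tau (insub a) else None.

Lemma positionE q tau (a : 'I_kappa) : (a < q)%N -> position q tau a = Some (tau a).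
Proof. by move=> aq; rewrite /position aq valK. Qed.

Lemma position_lt q tau a : (q <= kappa)%N -> (a < q)%N ->
  exists2 b : 'I_kappa, b = a :> nat & position q tau a = Some (tau b).
Proof.
move=> qk aq; have ak : (a < kappa)%N by exact: leq_trans aq qk.
by exists (Ordinal ak) => //; rewrite -[a]/(Ordinal ak : nat) positionE.
Qed.

Lemma position_ge q tau a : (q <= a)%N -> position q tau a = None.
Proof. by move=> qa; rewrite /position ltnNge qa. Qed.

(** Used with q = M for Y^j, where no place is sent to [None], and with q = M - 1 for X^k, where
    only the last one is. The bound on M keeps [None] from occurring twice. *)
Lemma position_inj q M tau : (q <= kappa)%N -> (M <= q.+1)%N ->
  injective (fun a : 'I_M => position q tau a).
Proof.
move=> qk Mq a b; have [aq|qa] := ltnP a q.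
  have [a' Ea ->] := position_lt tau qk aq; have [bq|qb] := ltnP b q.
    have [b' Eb ->] := position_lt tau qk bq => -[/perm_inj E].
    by apply: val_inj; rewrite /= -Ea -Eb E.
  by rewrite position_ge.
rewrite position_ge //; have [bq|qb _] := ltnP b q.
  by have [b' _ ->] := position_lt tau qk bq.
apply: val_inj => /=; have := ltn_ord a; have := ltn_ord b => bM aM.
have aq : (a <= q)%N by rewrite -ltnS (leq_trans aM).
have bq : (b <= q)%N by rewrite -ltnS (leq_trans bM).
by apply/eqP; rewrite eqn_leq (leq_trans aq) // (leq_trans bq).
Qed.

Lemma Some_in_positions q M (tau : 'S_kappa) (b : 'I_kappa) : (q <= kappa)%N -> (q <= M)%N ->
  (Some (tau b) \in (fun a : 'I_M => position q tau a) @: [set: 'I_M]) = (b < q)%N.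
Proof.
move=> qk qM; apply/imsetP/idP => [[a _]|bq].
  have [aq|qa] := ltnP a q; last by rewrite position_ge.
  by have [b' Eb ->] := position_lt tau qk aq => -[/perm_inj ->]; rewrite Eb.
by exists (Ordinal (leq_trans bq qM)) => //; rewrite /= positionE.
Qed.

Lemma None_in_positions q M tau : (q <= kappa)%N ->
  (None \in (fun a : 'I_M => position q tau a) @: [set: 'I_M]) = (q < M)%N.
Proof.
move=> qk; apply/imsetP/idP => [[a _]|qM].
  have [aq|qa _] := ltnP a q; last exact: leq_ltn_trans qa (ltn_ord a).
  by have [b' _ ->] := position_lt tau qk aq.
by exists (Ordinal qM) => //; rewrite position_ge.
Qed.

(** Reversed because [prolong] passes the reversed list of indices to its recursion. *)
Definition positions : seq (option 'I_kappa) := rev [seq Some a | a <- enum 'I_kappa].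

(** The places of tau from q on are the positions outside all blocks; the two lists of derivatives
    differ only in order. *)
Lemma x_partials_positions q M (tau : 'S_kappa) (f : 'rV[K]_(n + m) -> K)
    (P : {set {set option 'I_kappa}}) : (q <= kappa)%N -> (q <= M)%N -> smooth f ->
  cover P = (fun a : 'I_M => position q tau a) @: [set: 'I_M] ->
  partials [seq lshift m b | b <- drop q [seq tnth i (tau a) | a <- enum 'I_kappa]] f =
  x_partials idx positions P f.
Proof.
move=> qk qM sf cP; apply: (perm_partials hK) => //.
have -> : drop q [seq tnth i (tau a) | a <- enum 'I_kappa] =
    [seq idx t | t <- [seq Some (tau a) | a <- drop q (enum 'I_kappa)]].
  by rewrite -map_drop -map_comp; apply: eq_map => a /=; rewrite idxE.
rewrite -map_comp; apply/(@perm_map _ _ (fun t => lshift m (idx t)))/uniq_perm.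
- rewrite map_inj_uniq => [|a b [/perm_inj]//].
  by apply: drop_uniq; exact: enum_uniq.
- by rewrite filter_uniq // rev_uniq map_inj_uniq ?enum_uniq // => a b [].
move=> t; rewrite mem_filter mem_rev cP.
apply/mapP/andP => [[a]|[tq /mapP[b _ E]]].
  rewrite mem_drop_enum_ord => qa ->; rewrite Some_in_positions // -leqNgt; split=> //.
  by apply/mapP; exists (tau a); rewrite ?mem_enum.
move: tq; rewrite E -(permKV tau b) Some_in_positions // -leqNgt => qb.
by exists (tau^-1 b)%g; rewrite ?mem_drop_enum_ord ?permKV.
Qed.

Context (d r s : nat) (lam : {ffun 'I_d -> 'I_r}) (mu : {ffun 'I_d -> 'I_s}).
Notation M := (weight lam mu).
Hypothesis lam_gt0 : forall e, (0 < lam e)%N.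

(** Once k satisfies the equations imposed by the Kronecker symbols, the jet variable of b carries
    the indices found at the positions of its block. *)
Lemma seq_mset_lower_indices (h : option 'I_kappa -> 'I_n) q tau (sigma : 'S_M)
    (k : 'I_M -> 'I_n) b : (q <= kappa)%N -> (M <= q.+1)%N ->
  (forall a, k (sigma a) = h (position q tau a)) ->
  seq_mset (lower_indices k b) =
  block_mset h (block_image (fun a : 'I_M => position q tau a) sigma b).
Proof.
move=> qk Mq kE; apply/eq_seq_msetP; apply: perm_trans (perm_lower_indices _ _) _.
have rI := position_inj (tau := tau) qk Mq.
have -> : [seq k a | a <- enum (fiber lam b)] =
    [seq h t | t <- [seq position q tau ((sigma^-1)%g a) | a <- enum (fiber lam b)]].
  by rewrite -map_comp; apply: eq_map => a /=; rewrite -kE permKV.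
apply/perm_map/uniq_perm; rewrite ?enum_uniq //.
  by rewrite map_inj_uniq ?enum_uniq // => a a' /rI/perm_inj.
move=> t; rewrite mem_enum block_imageE; apply/mapP/imsetP => [[a]|[_ /imsetP[a af ->] ->]].
  by rewrite mem_enum => af ->; exists ((sigma^-1)%g a); rewrite ?imset_f.
by exists a; rewrite ?mem_enum.
Qed.

Lemma kronecker_positions q (tau : 'S_kappa) (sigma : 'S_M) (k : 'I_M -> 'I_n) :
  (q <= kappa)%N -> (q <= M)%N ->
  kronecker K (take q [seq tnth i (tau a) | a <- enum 'I_kappa])
              (take q [seq k (sigma a) | a <- enum 'I_M]) =
  [forall a : 'I_M, (a < q)%N ==> (idx (position q tau a) == k (sigma a))]%:R.
Proof.
move=> qk qM; rewrite kronecker_eq.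
  rewrite -eq_take_map_enum; congr ((_ == _)%:R).
  have takeE N (G : nat -> 'I_n) : (q <= N)%N ->
      take q [seq G (val a) | a : 'I_N <- enum 'I_N] = map G (iota 0 q).
    move=> qN; rewrite (map_comp G val) val_enum_ord -map_take take_iota.
    by rewrite (minn_idPl qN).
  rewrite (takeE _ (fun a => idx (position q tau a))) //.
  rewrite -(takeE _ (fun a => idx (position q tau a)) qk) -2!map_take.
  apply/eq_in_map => a aq; rewrite positionE ?idxE //.
  by rewrite -mem_take_enum_ord.
by rewrite !size_takel // size_map size_enum_ord.
Qed.

Lemma sum_ffun_eq (F : {ffun 'I_M -> 'I_n} -> K) (k0 : {ffun 'I_M -> 'I_n})
    (P : pred {ffun 'I_M -> 'I_n}) :
  (forall k, P k = (k == k0)) -> \sum_k (P k)%:R * F k = F k0.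
Proof.
move=> Pk; rewrite (bigD1 k0) //= Pk eqxx mul1r big1 ?addr0 // => k /negPf nk.
by rewrite Pk nk mul0r.
Qed.

(** All M values of k are fixed by the Kronecker symbols, which leaves the single function [k0]; the
    remaining sum over l is the closed form of [jet_sum]. *)
Lemma collapse_Y (tau : 'S_kappa) (sigma : 'S_M) : (M <= kappa)%N ->
  \sum_(l : {ffun block mu -> 'I_m}) \sum_(k : {ffun 'I_M -> 'I_n})
     kronecker K (take M [seq tnth i (tau a) | a <- enum 'I_kappa])
                 [seq k (sigma a) | a <- enum 'I_M]
     * partials_xy (drop M [seq tnth i (tau a) | a <- enum 'I_kappa])
                   [seq l b | b <- enum {: block mu}] (Y j) (base u)
     * \prod_(b : block mu) u (ycoord (l b) (lower_indices k b))
  = prolong_term X Y j None idx positions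
      (image_partition (fun a : 'I_M => position M tau a) sigma) u.
Proof.
move=> Mk; set rho := fun a : 'I_M => position M tau a.
have rI : injective rho by exact: position_inj.
have [pP cP _] := image_partitionP lam_gt0 sigma rI.
rewrite /prolong_term cP None_in_positions // ltnn.
pose k0 : {ffun 'I_M -> 'I_n} := [ffun c => idx (rho (sigma^-1 c)%g)].
have k0E a : k0 (sigma a) = idx (rho a) by rewrite ffunE permK.
set xs := drop M _.
transitivity (\sum_(l : {ffun block mu -> 'I_m})
    partials [seq rshift n (l b) | b <- enum {: block mu}]
      (partials [seq lshift m a | a <- xs] (Y j)) (base u)
    * \prod_(b <- enum {: block mu}) u (inr (l b, block_mset idx (block_image rho sigma b)))
    * \prod_(b | b \notin enum {: block mu}) (fun _ _ => 1) b (l b)).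
  apply: eq_bigr => l _.
  transitivity (\sum_(k : {ffun 'I_M -> 'I_n})
      [forall a : 'I_M, (a < M)%N ==> (idx (position M tau a) == k (sigma a))]%:R *
      (partials_xy xs [seq l b | b <- enum {: block mu}] (Y j) (base u)
       * \prod_(b : block mu) u (ycoord (l b) (lower_indices k b)))).
    apply: eq_bigr => k _; rewrite -mulrA; congr (_ * _).
    rewrite -kronecker_positions //; congr kronecker.
    by rewrite take_oversize // size_map size_enum_ord.
  rewrite (@sum_ffun_eq _ k0) => [|k].
    rewrite [X in _ = _ * X]big1 ?mulr1 => [|b]; last by rewrite mem_enum.
    congr (_ * _).
      rewrite /partials_xy -partials_cat -map_comp; congr (_ (base u)).
      by apply: (perm_partials hK) => //; rewrite perm_catC.
    rewrite big_enum; apply: eq_bigr => b _; congr (u (inr (_, _))).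
    exact: (@seq_mset_lower_indices idx M tau sigma k0 b).
  apply/forallP/eqP => [H|-> a]; last by rewrite k0E eqxx implybT.
  apply/ffunP => c; rewrite ffunE.
  by have /implyP/(_ (ltn_ord _))/eqP -> := H (sigma^-1 c)%g; rewrite permKV.
apply: etrans (sum_ffun_jet_sum hK (fun b => block_mset idx (block_image rho sigma b))
  (fun _ _ => 1) u (smooth_partials _ (hY j)) (enum_uniq _)) _.
rewrite [X in _ * X]big1 ?mulr1 => [|b]; last by rewrite mem_enum.
rewrite /blocks_sum (x_partials_positions Mk (leqnn _) (hY j) cP).
rewrite (perm_jet_sum hK _ (perm_map _ (perm_enum_image_partition lam_gt0 sigma rI)));
  last exact: smooth_partials.
by rewrite -[in RHS]map_comp.
Qed.

(** The Kronecker symbols leave k_{sigma(M)} free: it becomes the summation index of X^k, the value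
    at [None]. The symbol delta_l^j makes the block of [None] carry the factor y^j, whose derivative
    is the omitted one. The sign undoes the one inside [prolong_term]. *)
Lemma collapse_X (tau : 'S_kappa) (sigma : 'S_M) (last : 'I_M) :
  last = M.-1 :> nat -> (M.-1 <= kappa)%N ->
  \sum_(l : {ffun block mu -> 'I_m}) \sum_(k : {ffun 'I_M -> 'I_n})
     kronecker K (take M.-1 [seq tnth i (tau a) | a <- enum 'I_kappa])
                 (take M.-1 [seq k (sigma a) | a <- enum 'I_M])
     * (l (block_of (sigma last)) == j)%:R
     * partials_xy (drop M.-1 [seq tnth i (tau a) | a <- enum 'I_kappa])
                   [seq l b | b <- enum {: block mu} & b != block_of (sigma last)]
                   (X (k (sigma last))) (base u)
     * \prod_(b : block mu) u (ycoord (l b) (lower_indices k b))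
  = - prolong_term X Y j None idx positions
        (image_partition (fun a : 'I_M => position M.-1 tau a) sigma) u.
Proof.
move=> lastE qk; set rho := fun a : 'I_M => position M.-1 tau a.
have M0 : (0 < M)%N by exact: leq_ltn_trans (ltn_ord last).
have qM : (M.-1 <= M)%N by exact: leq_pred.
have MSq : (M <= M.-1.+1)%N by rewrite prednK.
have rI : injective rho by exact: position_inj.
have [pP cP _] := image_partitionP lam_gt0 sigma rI.
set b0 := block_of (sigma last).
have rho_last : rho last = None by rewrite /rho position_ge ?lastE.
have lastP (a : 'I_M) : ~~ (a < M.-1)%N -> a = last.
  rewrite -leqNgt => qa; apply: val_inj; apply/eqP; rewrite /= lastE eqn_leq qa andbT.
  by rewrite -ltnS prednK.
have b0P : block_image rho sigma b0 \in image_partition rho sigma by exact: imset_f.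
have None_b0 : None \in block_image rho sigma b0 by rewrite -rho_last mem_block_image.
rewrite (prolong_term_star _ _ _ _ _ _ pP b0P None_b0) opprK.
set xs := drop M.-1 _.
pose k0 (k' : 'I_n) : {ffun 'I_M -> 'I_n} :=
  [ffun c => idx_at None idx k' (rho (sigma^-1 c)%g)].
have k0E k' a : k0 k' (sigma a) = idx_at None idx k' (rho a) by rewrite ffunE permK.
pose bs := [seq b <- enum {: block mu} | b != b0].
have us : uniq bs by rewrite filter_uniq ?enum_uniq.
have in_s b : (b \in bs) = (b != b0) by rewrite mem_filter mem_enum andbT.
transitivity (\sum_(k' < n) \sum_(l : {ffun block mu -> 'I_m})
    partials [seq rshift n (l b) | b <- bs]
      (partials [seq lshift m a | a <- xs] (X k')) (base u)
    * \prod_(b <- bs) u (inr (l b, block_mset (idx_at None idx k') (block_image rho sigma b)))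
    * \prod_(b | b \notin bs) (fun b l' => (l' == j)%:R *
         u (inr (l', block_mset (idx_at None idx k') (block_image rho sigma b)))) b (l b)).
  rewrite [RHS]exchange_big /=; apply: eq_bigr => l _.
  (* The functions k are grouped by their value k' at [sigma last]; only the [k0 k'] with this value
     can equal k. *)
  transitivity (\sum_(k' < n) \sum_(k : {ffun 'I_M -> 'I_n})
      (k == k0 k')%:R *
      ((l b0 == j)%:R * partials_xy xs [seq l b | b <- bs] (X k') (base u)
       * \prod_(b : block mu) u (ycoord (l b) (lower_indices k b)))).
    rewrite [RHS]exchange_big /=; apply: eq_bigr => k _.
    rewrite (bigD1 (k (sigma last))) //= [X in _ = _ + X]big1 ?addr0; last first.
      move=> k' /negPf nk; suff /negPf -> : k != k0 k' by rewrite mul0r.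
      by apply/eqP => E; move: nk; rewrite E k0E rho_last /idx_at /= eqxx.
    rewrite kronecker_positions // !mulrA; congr ((nat_of_bool _)%:R * _ * _ * _).
    apply/forallP/eqP => [H|E a]; last first.
      apply/implyP => aq; rewrite E k0E /idx_at.
      by have [b _ Eb] := position_lt tau qk aq; rewrite /rho Eb eqxx.
    apply/ffunP => c; rewrite -(permKV sigma c) k0E; set a := (sigma^-1 c)%g.
    have [aq|/lastP ->] := boolP (a < M.-1)%N; last by rewrite rho_last /idx_at eqxx.
    have /implyP/(_ aq)/eqP <- := H a.
    by have [b _ Eb] := position_lt tau qk aq; rewrite /rho Eb.
  apply: eq_bigr => k' _; rewrite (@sum_ffun_eq _ (k0 k')) //.
  have mE b : seq_mset (lower_indices (k0 k') b) =
      block_mset (idx_at None idx k') (block_image rho sigma b).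
    exact: (@seq_mset_lower_indices _ M.-1 tau sigma).
  rewrite [X in _ = _ * X](big_pred1 b0) => [|b]; last by rewrite in_s negbK.
  rewrite (bigD1 b0) //= {1}/ycoord mE.
  rewrite [X in _ * (_ * X) = _](_ : _ =
      \prod_(b <- bs) u (inr (l b, block_mset (idx_at None idx k') (block_image rho sigma b))));
    last first.
    rewrite big_filter big_enum_cond /=.
    by apply: eq_big => [b|b _]; rewrite ?andbT // /ycoord mE.
  rewrite /partials_xy -partials_cat.
  rewrite (@perm_partials _ _ hK _ _ ([seq lshift m a | a <- xs] ++ _)
    ([seq rshift n (l b) | b <- bs] ++ [seq lshift m a | a <- xs])) //.
    have mul4 (a b c e : K) : a * b * (c * e) = b * e * (a * c) by ring.
    by rewrite partials_cat; exact: mul4.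
  by rewrite perm_catC -map_comp.
apply: eq_bigr => k' _.
apply: etrans (sum_ffun_jet_sum hK
  (fun b => block_mset (idx_at None idx k') (block_image rho sigma b))
  (fun b l' => (l' == j)%:R *
     u (inr (l', block_mset (idx_at None idx k') (block_image rho sigma b))))
  u (smooth_partials _ (hX k')) us) _.
rewrite (big_pred1 b0) => [|b]; last by rewrite in_s negbK.
rewrite (bigD1 j) //= eqxx mul1r big1 ?addr0 => [|l /negPf ->]; last by rewrite mul0r.
congr (_ * _).
rewrite /blocks_sum (x_partials_positions qk qM (hX k') cP).
rewrite (map_comp (block_mset _) (block_image rho sigma)).
apply: (perm_jet_sum hK); last exact: smooth_partials.
apply/perm_map/uniq_perm => [||B]; rewrite ?enum_uniq //.
  by rewrite map_inj_uniq //; exact: block_image_inj.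
rewrite mem_enum !inE; apply/mapP/andP => [[b]|[Bb0 /imsetP[b _ E]]].
  rewrite in_s => bb0 ->; rewrite imset_f //; split=> //.
  by apply: contra bb0 => /eqP E; apply/eqP; exact: (block_image_inj lam_gt0 rI E).
by exists b; rewrite // in_s; apply: contra Bb0 => /eqP <-; rewrite E.
Qed.

End CollapseIndices.

(** * Comparing the two sides family by family *)

Section SumOfTerms.
Import mathcomp.boot.fintype mathcomp.boot.finset.
Context (R : realType) (K : numFieldType).
Hypothesis hK : K = R :> numFieldType \/ K = R[i] :> numFieldType.
Context (n m : nat).
Context (X : 'I_n -> 'rV[K]_(n + m) -> K) (Y : 'I_m -> 'rV[K]_(n + m) -> K).
Hypotheses (hX : forall k, smooth (X k)) (hY : forall j, smooth (Y j)).
Context (j : 'I_m) (kappa : nat) (i : kappa.-tuple 'I_n) (u : jet K n m).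
Context (idx : option 'I_kappa -> 'I_n).
Hypothesis idxE : forall a, idx (Some a) = tnth i a.

Notation term := (prolong_term X Y j None idx (positions kappa)).

(** The empty family is the pure x-derivative that stands before the sum over d. The others are
    split according to whether [None] is in a block, that is, between X^k and Y^j. *)
Lemma prolong_sum_partitions :
  prolong X Y j i u =
  partials_xy i [::] (Y j) (base u)
  + (\sum_(P | [&& partial_partition [set: option 'I_kappa] P, None \notin cover P,
                   P != set0 & [set: option 'I_kappa] \notin P]) term P u
  +  \sum_(P | [&& partial_partition [set: option 'I_kappa] P, None \in cover P,
                   P != set0 & [set: option 'I_kappa] \notin P]) term P u).
Proof.
have iE : rev i = [seq idx t | t <- positions kappa].
  rewrite /positions map_rev -map_comp -{1}[tval i]map_tnth_enum; congr rev.
  by apply: eq_map => a /=; rewrite idxE.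
have uP : uniq (positions kappa).
  by rewrite rev_uniq map_inj_uniq ?enum_uniq // => a b [].
have nP : None \notin positions kappa.
  by rewrite mem_rev; apply/mapP => -[].
have allT : None |: [set t in positions kappa] = [set: option 'I_kappa].
  apply/setP => -[a|]; rewrite !inE //= mem_rev.
  by apply/mapP; exists a; rewrite ?mem_enum.
rewrite /prolong iE (prolong_revE hK hX hY j idx u uP nP) allT.
(* A block of all the positions would meet any other block, so it can only be alone. *)
have setT_in P : partial_partition [set: option 'I_kappa] P ->
    (P != [set [set: option 'I_kappa]]) = ([set: option 'I_kappa] \notin P).
  move=> pP; congr negb; apply/eqP/idP => [->|TP]; first by rewrite set11.
  case/partial_partitionP: pP => tr P0 _; apply/setP => B; rewrite inE.
  apply/idP/eqP => [BP|-> //]; have [y yB] := P0 B BP.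
  by apply: (tr _ _ y); rewrite ?inE.
have p0 : partial_partition [set: option 'I_kappa] set0.
  by apply/partial_partitionP; split=> B; rewrite inE.
rewrite (bigD1 set0) /=; last by rewrite p0 setT_in ?inE.
congr (_ + _).
  rewrite /prolong_term /cover big_set0 inE /blocks_sum enum_set0 /=.
  rewrite /x_partials /partials_xy cats0; congr (_ (base u)).
  apply: (perm_partials hK) => //.
  rewrite (eq_filter (a2 := predT)) ?filter_predT => [|t]; last by rewrite /cover big_set0 inE.
  rewrite (map_comp (lshift m) idx) -iE.
  by apply: perm_map; rewrite perm_rev.
rewrite (bigID (fun P => None \notin cover P)) /=; congr (_ + _).
  apply: eq_bigl => P; have [pP|] //= := boolP (partial_partition _ P).
  by rewrite setT_in //; case: (None \notin _); rewrite ?andbF ?andbT // andbC.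
apply: eq_bigl => P; have [pP|] //= := boolP (partial_partition _ P).
by rewrite setT_in // negbK; case: (None \in _); rewrite ?andbF ?andbT // andbC.
Qed.

Context (d : nat) (lam : {ffun 'I_d -> 'I_kappa.+1}) (mu : {ffun 'I_d -> 'I_kappa.+2}).
Notation M := (weight lam mu).
Hypotheses (lam_gt0 : forall e, (0 < lam e)%N) (mu_gt0 : forall e, (0 < mu e)%N).
Hypotheses (d_gt0 : (0 < d)%N) (M_le : (M <= kappa.+1)%N).

Lemma weight_gt0 : (0 < M)%N.
Proof. by rewrite /weight (bigD1 (Ordinal d_gt0)) //= addn_gt0 muln_gt0 mu_gt0 lam_gt0. Qed.

(** Without [None], A has q elements, and a shuffle with these as its first q values exists; [None]
    accounts for the possible difference between M and q. *)
Lemma positions_surj q (A : {set option 'I_kappa}) : (q <= kappa)%N -> (q <= M <= q.+1)%N ->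
  (None \in A) = (q < M)%N -> #|A| = M ->
  exists2 tau : 'S_kappa, tau \in shuffles kappa q &
    (fun a : 'I_M => position q tau a) @: [set: 'I_M] = A.
Proof.
move=> qk /andP[qM Mq] NA cA; pose B := [set a : 'I_kappa | Some a \in A].
have cB : #|B| = q.
  have AE : A = (if None \in A then [set None] else set0) :|: Some @: B.
    apply/setP => -[a|]; rewrite in_setU.
      rewrite (mem_imset _ _ (@Some_inj _)) inE.
      by case: ifP => _; rewrite inE.
    rewrite [None \in Some @: B](_ : _ = false) ?orbF; last by apply/imsetP => -[].
    by case: ifP; rewrite inE.
  have := cA; rewrite {1}AE cardsU NA.
  rewrite [_ :&: _](_ : _ = set0) ?cards0 ?subn0; last first.
    apply/setP => -[a|]; rewrite !inE; first by case: ifP; rewrite inE.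
    by rewrite andbC; apply/negbTE; rewrite negb_and; apply/orP; left; apply/imsetP => -[].
  rewrite card_imset; last exact: Some_inj.
  have [qM'|Mq'] := ltnP q M.
    rewrite cards1 => cM; apply: succn_inj; rewrite -add1n cM.
    by apply/eqP; rewrite eqn_leq Mq qM'.
  by rewrite cards0 add0n => ->; apply/eqP; rewrite eqn_leq Mq' qM.
have [tau tauS tauB] := shuffles_surj B; rewrite cB in tauS tauB.
exists tau => //; apply/setP => -[b|].
  rewrite -(permKV tau b) Some_in_positions //.
  rewrite -[RHS](_ : (tau (tau^-1 b)%g \in B) = _); last by rewrite inE.
  by rewrite -tauB mem_initial_image.
by rewrite None_in_positions // NA.
Qed.

Lemma positions_shuffle_inj q : (q <= kappa)%N -> (q <= M)%N ->
  {in shuffles kappa q &, injective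
     (fun tau : 'S_kappa => (fun a : 'I_M => position q tau a) @: [set: 'I_M])}.
Proof.
move=> qk qM tau tau' tS tS' E; apply: (shuffles_inj tS tS'); apply/setP => x.
rewrite -{1}(permKV tau x) mem_initial_image -(Some_in_positions tau _ qk qM) E permKV.
by rewrite -{1}(permKV tau' x) Some_in_positions // -(mem_initial_image tau') permKV.
Qed.

Context (S : {set 'S_M}).
Hypothesis hS : coset_representatives S.

Lemma sum_Y_terms :
  \sum_(l : {ffun block mu -> 'I_m}) \sum_(k : {ffun 'I_M -> 'I_n})
    (\sum_(sigma in S) \sum_(tau in shuffles kappa M)
       kronecker K (take M [seq tnth i (tau a) | a <- enum 'I_kappa])
                   [seq k (sigma a) | a <- enum 'I_M]
       * partials_xy (drop M [seq tnth i (tau a) | a <- enum 'I_kappa])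
                     [seq l b | b <- enum {: block mu}] (Y j) (base u))
    * \prod_(b : block mu) u (ycoord (l b) (lower_indices k b))
  = \sum_(P | [&& partial_partition [set: option 'I_kappa] P, None \notin cover P &
                  has_block_type lam mu P]) term P u.
Proof.
have shuffle_le tau : tau \in shuffles kappa M -> (M <= kappa)%N.
  rewrite /shuffles (gtn_eqF weight_gt0) /=; case: eqP => [->//|_].
  by case: ltnP => [Mk _|_]; [exact: ltnW | rewrite inE].
transitivity (\sum_(sigma in S) \sum_(tau in shuffles kappa M)
    term (image_partition (fun a : 'I_M => position M tau a) sigma) u); last first.
  have H := @coset_position_sum _ _ _ lam mu lam_gt0 _ _ (fun P => term P u) S _
    (shuffles kappa M) (fun tau (a : 'I_M) => position M tau a)
    (fun A => None \notin A) hS.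
  apply: H.
  - move=> tau /shuffle_le Mk; split; first exact: position_inj.
    by rewrite None_in_positions // ltnn.
  - move=> tau tau' tS; exact: positions_shuffle_inj (shuffle_le _ tS) (leqnn _) _ _ tS.
  - move=> A NA cA; apply: positions_surj; rewrite ?leqnn ?ltnn ?leqnSn //; last exact: negbTE.
    (* As A omits [None], it has at most kappa elements. For M = kappa + 1 no family is counted, in
       agreement with the empty set of shuffles. *)
    have cT : #|{: option 'I_kappa}| = kappa.+1 by rewrite card_option card_ord.
    rewrite -ltnS -cA -cT; apply: proper_card.
    by apply/properP; split; [apply/subsetP | exists None].
under eq_bigr do under eq_bigr do rewrite mulr_suml.
under eq_bigr do rewrite exchange_big.
rewrite exchange_big; apply: eq_bigr => sigma _ /=.
under eq_bigr do under eq_bigr do rewrite mulr_suml.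
under eq_bigr do rewrite exchange_big.
rewrite exchange_big; apply: eq_bigr => tau tS /=.
exact: (collapse_Y hK X hY j u idxE lam_gt0 tau sigma (shuffle_le _ tS)).
Qed.

Lemma sum_X_terms (last : 'I_M) : last = M.-1 :> nat ->
  \sum_(l : {ffun block mu -> 'I_m}) \sum_(k : {ffun 'I_M -> 'I_n})
    (\sum_(sigma in S) \sum_(tau in shuffles kappa M.-1)
       kronecker K (take M.-1 [seq tnth i (tau a) | a <- enum 'I_kappa])
                   (take M.-1 [seq k (sigma a) | a <- enum 'I_M])
       * (l (block_of (sigma last)) == j)%:R
       * partials_xy (drop M.-1 [seq tnth i (tau a) | a <- enum 'I_kappa])
                     [seq l b | b <- enum {: block mu} & b != block_of (sigma last)]
                     (X (k (sigma last))) (base u))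
    * \prod_(b : block mu) u (ycoord (l b) (lower_indices k b))
  = - \sum_(P | [&& partial_partition [set: option 'I_kappa] P, None \in cover P &
                    has_block_type lam mu P]) term P u.
Proof.
move=> lastE; have M0 := weight_gt0.
have qk : (M.-1 <= kappa)%N by rewrite -ltnS prednK.
have qM : (M.-1 < M)%N by rewrite prednK.
transitivity (\sum_(sigma in S) \sum_(tau in shuffles kappa M.-1)
    - term (image_partition (fun a : 'I_M => position M.-1 tau a) sigma) u); last first.
  rewrite -sumrN.
  have H := @coset_position_sum _ _ _ lam mu lam_gt0 _ _ (fun P => - term P u) S _
    (shuffles kappa M.-1) (fun tau (a : 'I_M) => position M.-1 tau a)
    (fun A => None \in A) hS.
  apply: H.
  - move=> tau _; split; first by apply: position_inj; rewrite ?prednK.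
    by rewrite None_in_positions.
  - exact: positions_shuffle_inj (leq_pred _).
  - move=> A NA cA; apply: positions_surj; rewrite ?leq_pred ?prednK ?leqnn //.
under eq_bigr do under eq_bigr do rewrite mulr_suml.
under eq_bigr do rewrite exchange_big.
rewrite exchange_big; apply: eq_bigr => sigma _ /=.
under eq_bigr do under eq_bigr do rewrite mulr_suml.
under eq_bigr do rewrite exchange_big.
rewrite exchange_big; apply: eq_bigr => tau tS /=.
exact: (collapse_X hK Y hX j u idxE lam_gt0 tau sigma lastE qk).
Qed.

End SumOfTerms.

Theorem theorem5p12
  (R : realType) (K : numFieldType)
  (hK : K = R :> numFieldType \/ K = R[i] :> numFieldType)
  (n m : nat) (hn : (1 <= n)%N) (hm : (1 <= m)%N)
  (X : 'I_n -> 'rV[K]_(n + m) -> K) (Y : 'I_m -> 'rV[K]_(n + m) -> K)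
  (hX : forall k, smooth (X k)) (hY : forall j, smooth (Y j))
  (j : 'I_m) (kappa : nat) (hkappa : (1 <= kappa)%N) (i : kappa.-tuple 'I_n)
  (* a choice of representatives of the cosets, for all d, lambda and mu *)
  (FF : forall (d : nat) (lam : {ffun 'I_d -> 'I_kappa.+1})
               (mu : {ffun 'I_d -> 'I_kappa.+2}), {set 'S_(weight lam mu)})
  (hFF : forall d lam mu, coset_representatives (FF d lam mu))
  (u : jet K n m) :
  prolong X Y j i u =
    partials_xy i [::] (Y j) (base u)
    + \sum_(1 <= d < kappa.+2)
      \sum_(lam : {ffun 'I_d -> 'I_kappa.+1} |
              [forall e, (1 <= lam e)%N] &&
              [forall e : 'I_d, forall e' : 'I_d, (e < e')%N ==> (lam e < lam e')%N])
      \sum_(mu : {ffun 'I_d -> 'I_kappa.+2} |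
              [forall e, (1 <= mu e)%N] && (weight lam mu <= kappa.+1)%N)
      \sum_(l : {ffun block mu -> 'I_m})
      \sum_(k : {ffun 'I_(weight lam mu) -> 'I_n})
        let M := weight lam mu in
        let k_ (sigma : 'S_M) := [seq k (sigma a) | a <- enum 'I_M] in
        let i_ (tau : 'S_kappa) := [seq tnth i (tau a) | a <- enum 'I_kappa] in
        ( \sum_(sigma in FF d lam mu) \sum_(tau in shuffles kappa M)
            kronecker K (take M (i_ tau)) (k_ sigma)
            * partials_xy (drop M (i_ tau)) [seq l b | b <- enum {: block mu}]
                (Y j) (base u)
          (* [last] is the index M; it exists because M >= 1 *)
        - (if insub M.-1 is Some last then
             \sum_(sigma in FF d lam mu) \sum_(tau in shuffles kappa M.-1)
               kronecker K (take M.-1 (i_ tau)) (take M.-1 (k_ sigma))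
               * (l (block_of (sigma last)) == j)%:R
               * partials_xy (drop M.-1 (i_ tau))
                   [seq l b | b <- enum {: block mu}
                            & b != block_of (sigma last)]
                   (X (k (sigma last))) (base u)
           else 0) )
        * \prod_(b : block mu) u (ycoord (l b) (lower_indices k b)).
Proof.
(* The value at [None] is a placeholder: when [None] lies in a block, [idx_at] replaces it by the
   summation index, and otherwise no index is read there. *)
pose idx (t : option 'I_kappa) := if t is Some a then tnth i a else tnth i (Ordinal hkappa).
have idxE a : idx (Some a) = tnth i a by [].
rewrite (prolong_sum_partitions hK hX hY j u idxE); congr (_ + _).
have cardT : #|{: option 'I_kappa}| = kappa.+1 by rewrite card_option card_ord.
have sumE := sum_types (fun P => prolong_term X Y j None idx (positions kappa) P u) cardT.
rewrite -(sumE (fun A => None \notin A)) -(sumE (fun A => None \in A)) -big_split /=.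
apply: eq_big_nat => d /andP[d_gt0 _].
rewrite -big_split; apply: eq_bigr => lam /andP[/forallP lam_gt0 _] /=.
rewrite -big_split; apply: eq_bigr => mu /andP[/forallP mu_gt0 M_le] /=.
have hS := hFF d lam mu.
have M_gt0 := weight_gt0 lam_gt0 mu_gt0 d_gt0.
case: insubP => [last _ lastE|]; last by rewrite ltn_predL M_gt0.
under [RHS]eq_bigr do under eq_bigr do rewrite mulrBl.
under [RHS]eq_bigr do rewrite sumrB.
rewrite sumrB (sum_Y_terms hK X hY j u idxE lam_gt0 mu_gt0 d_gt0 hS).
by rewrite (sum_X_terms hK Y hX j u idxE lam_gt0 mu_gt0 d_gt0 M_le hS lastE) opprK.
Qed.
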